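(* For all $m,n\ge 1$, $|W_n^{-1}(P_m;123)| = |W_n^{-1}(K_{1,m};132)|$.
   Context: For $\pi=\pi_1\cdots\pi_n\in\mathcal{S}_n$, the digraph $D(\pi)$ has vertices $1,\dots,n$ and an arc from $j$ to $i$ whenever $i<j$ and $\pi_i<\pi_j$. The weighted competition graph $W(\pi)$ is the edge-weighted simple graph on the same vertices in which distinct $u,v$ are joined by an edge iff they have a common out-neighbor in $D(\pi)$, with weight equal to the number of common out-neighbors. $P_m$ is the path with $m+1$ vertices and $m$ edges and $K_{1,m}$ is the star with one center and $m$ leaves, all edge weights equal to $1$. For an edge-weighted graph $G$ and a pattern $\tau$, $W_n^{-1}(G;\tau)$ is the set of $\pi\in\mathcal{S}_n$ avoiding $\tau$ (having no subsequence order-isomorphic to $\tau$) such that $W(\pi)$ is isomorphic, as an edge-weighted graph, to $G$ together with some number of isolated vertices. *)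

(* Defs.v *)
From mathcomp Require Import all_boot all_fingroup.
From mathcomp Require Import boolp.

Set Implicit Arguments.
Unset Strict Implicit.
Unset Printing Implicit Defensive.

(* Only the values of [wt] on adjacent pairs are meaningful. *)
Record wgraph := WGraph {
  vert : finType;
  adj : rel vert;
  wt : vert -> vert -> nat;
  adj_sym : symmetric adj;
  adj_irr : irreflexive adj;
  wt_sym : forall u v, adj u v -> wt u v = wt v u
}.

Definition wg_iso (G H : wgraph) : Prop :=
  exists f : vert G -> vert H,
    [/\ bijective f,
        forall u v, adj (f u) (f v) = adj u v
      & forall u v, adj u v -> wt (f u) (f v) = wt u v].

Section AddIsolated.
Variables (G : wgraph) (k : nat).

Definition isol_adj (u v : vert G + 'I_k) : bool :=
  match u, v with inl x, inl y => adj x y | _, _ => false end.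

Definition isol_wt (u v : vert G + 'I_k) : nat :=
  match u, v with inl x, inl y => wt x y | _, _ => 0 end.

Fact isol_adj_sym : symmetric isol_adj.
Proof. by move=> [x|x] [y|y] //=; apply: adj_sym. Qed.

Fact isol_adj_irr : irreflexive isol_adj.
Proof. by move=> [x|x] //=; apply: adj_irr. Qed.

Fact isol_wt_sym u v : isol_adj u v -> isol_wt u v = isol_wt v u.
Proof. by case: u v => [x|x] [y|y] //=; apply: wt_sym. Qed.

Definition add_isolated : wgraph :=
  @WGraph (vert G + 'I_k)%type isol_adj isol_wt
    isol_adj_sym isol_adj_irr isol_wt_sym.

End AddIsolated.

Section UnitWeight.
Variables (V : finType) (e : rel V).
Hypotheses (e_sym : symmetric e) (e_irr : irreflexive e).

Definition unit_wgraph : wgraph :=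
  @WGraph V e (fun _ _ => 1) e_sym e_irr (fun _ _ _ => erefl).

End UnitWeight.

Section PathStar.
Variable m : nat.

Definition path_adj (i j : 'I_m.+1) : bool :=
  (i.+1 == j :> nat) || (j.+1 == i :> nat).

Fact path_adj_sym : symmetric path_adj.
Proof. by move=> i j; rewrite /path_adj orbC. Qed.

Fact path_adj_irr : irreflexive path_adj.
Proof. by move=> i; rewrite /path_adj orbb -[X in _ == X]addn0 -addn1 eqn_add2l. Qed.

Definition path_graph : wgraph := unit_wgraph path_adj_sym path_adj_irr.

Definition star_adj (i j : 'I_m.+1) : bool :=
  (i != j) && ((i == ord0) || (j == ord0)).

Fact star_adj_sym : symmetric star_adj.
Proof. by move=> i j; rewrite /star_adj eq_sym orbC. Qed.

Fact star_adj_irr : irreflexive star_adj.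
Proof. by move=> i; rewrite /star_adj eqxx. Qed.

Definition star_graph : wgraph := unit_wgraph star_adj_sym star_adj_irr.

End PathStar.

Section Competition.
Variables (n : nat) (s : 'S_n).

Definition darc (j i : 'I_n) : bool := (i < j) && (s i < s j).

Definition common_out (u v : 'I_n) : {set 'I_n} :=
  [set x | darc u x && darc v x].

Definition comp_adj (u v : 'I_n) : bool :=
  (u != v) && (common_out u v != set0).

Definition comp_wt (u v : 'I_n) : nat := #|common_out u v|.

Fact common_outC u v : common_out u v = common_out v u.
Proof. by apply/setP=> x; rewrite !inE andbC. Qed.

Fact comp_adj_sym : symmetric comp_adj.
Proof. by move=> u v; rewrite /comp_adj eq_sym common_outC. Qed.

Fact comp_adj_irr : irreflexive comp_adj.
Proof. by move=> u; rewrite /comp_adj eqxx. Qed.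

Fact comp_wt_sym u v : comp_adj u v -> comp_wt u v = comp_wt v u.
Proof. by move=> _; rewrite /comp_wt common_outC. Qed.

Definition competition_graph : wgraph :=
  @WGraph 'I_n comp_adj comp_wt comp_adj_sym comp_adj_irr comp_wt_sym.

End Competition.

(* [f] lists the positions of a subsequence of [s] order-isomorphic to [t]. *)
Definition contains n k (s : 'S_n) (t : 'S_k) : Prop :=
  exists f : 'I_k -> 'I_n,
    (forall a b : 'I_k, a < b -> f a < f b) /\
    (forall a b : 'I_k, (s (f a) < s (f b)) = (t a < t b)).

Definition avoids n k (s : 'S_n) (t : 'S_k) : Prop := ~ contains s t.

(* Positions and values are numbered from 0, so 123 is 0 |-> 0, 1 |-> 1,
   2 |-> 2 and 132 is 0 |-> 0, 1 |-> 2, 2 |-> 1. *)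
Definition pat123 : 'S_3 := 1%g.
Definition pat132 : 'S_3 := tperm (inord 1) (inord 2).

Definition Winv n (G : wgraph) k (t : 'S_k) : {set 'S_n} :=
  [set s : 'S_n |
     `[< avoids s t /\
         exists r, wg_iso (competition_graph s) (add_isolated G r) >]].

(* Main.v *)
Require Import Defs.
From mathcomp Require Import all_boot all_fingroup.
From mathcomp Require Import boolp zify.

Set Implicit Arguments.
Unset Strict Implicit.
Unset Printing Implicit Defensive.

(** Both families are recognised on the Lehmer code
    [c_p = #{i < p | s_i < s_p}], which is a bijection from [S_n] to the
    sequences with [c_p <= p].

    If [s] avoids 123, the out-neighbours of a non-minimum are consecutive
    left-to-right minima, and two non-minima compete when their intervals of
    minima meet. A triangle-free graph then only joins consecutive non-minima,
    and unit weight means that the later interval reaches exactly one minimum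
    past the [z] minima lying between the two, i.e. [c_p = z + 1]. The
    competition graph is a path with [m] edges iff there are [m] such
    contacts, they are consecutive, and none but the last has [z = 0].

    If [s] avoids 132, the code of its reverse-complement [t] is the sequence of
    depths, in preorder, of a plane forest. An entry 2 creates an edge between the
    parent and the root of the vertex, and an entry at least 3 creates a triangle.
    The graph is a star with [m] edges iff the code has letters at most 2, has no
    factor 22, and has exactly [m] letters 2, all of them in the same tree.

    Both conditions are tested by automata reading the code from left to right,
    and the numbers of accepted codes satisfy the same recurrence. *)

(** * Lehmer codes *)

Section Lehmer.
Variable g : nat -> nat.

Definition lehmer p := count (fun i => g i < g p) (iota 0 p).

Lemma lehmer_le p : lehmer p <= p.
Proof. by rewrite -[X in _ <= X](size_iota 0 p) count_size. Qed.

Lemma lehmer0P p : reflect (forall x, x < p -> g p <= g x) (lehmer p == 0).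
Proof.
rewrite -leqn0 leqNgt -has_count.
apply: (iffP hasPn) => h x; first by move=> xp; have := h x; rewrite mem_iota; lia.
by rewrite mem_iota => /andP[_ xp]; have := h x xp; lia.
Qed.

Lemma lehmer_gt0P p : reflect (exists2 x, x < p & g x < g p) (0 < lehmer p).
Proof.
rewrite -has_count; apply: (iffP hasP) => -[x xp gx]; exists x => //.
  by move: xp; rewrite mem_iota.
by rewrite mem_iota.
Qed.

(** The entries below [g p] form an initial segment of the sorted prefix, so [i] belongs to it
    exactly when its rank is less than the size [lehmer p] of the segment. *)
Lemma lehmer_rank p i : injective g -> i < p ->
  (g i < g p) = (count (fun y => g y < g i) (iota 0 p) < lehmer p).
Proof.
move=> gI ip; case: ltnP => [lt|le]; apply/esym.
  have -> : lehmer p = count (fun y => g y < g i) (iota 0 p) +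
      count (fun y => g i <= g y < g p) (iota 0 p).
    rewrite -count_predUI [X in _ + X](_ : _ = 0) ?addn0.
      by apply: eq_count => y /=; lia.
    by apply/eqP; rewrite -leqn0 leqNgt -has_count; apply/hasPn => y _ /=; lia.
  rewrite -[X in X < _]addn0 ltn_add2l -has_count; apply/hasP; exists i; last by lia.
  by rewrite mem_iota.
apply/negbTE; rewrite -leqNgt; apply: sub_count => y /=; lia.
Qed.

End Lehmer.

(** The default value [i] keeps the extension injective on all of [nat]. *)
Definition perm_fun n (s : 'S_n) (i : nat) : nat :=
  if insub i is Some o then s o else i.

Lemma perm_funE n (s : 'S_n) (i : 'I_n) : perm_fun s i = s i.
Proof. by rewrite /perm_fun valK. Qed.

Lemma perm_fun_inj n (s : 'S_n) : injective (perm_fun s).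
Proof.
move=> i j; rewrite /perm_fun.
case: (@insubP _ _ ('I_n) i) => [o lo <-|ni]; case: (@insubP _ _ ('I_n) j) => [o' lo' <-|nj] //.
- by move=> /val_inj /perm_inj ->.
- by move=> e; case/negP: nj; rewrite -e.
- by move=> e; case/negP: ni; rewrite e.
Qed.

Definition code n (s : 'S_n) : seq nat := mkseq (lehmer (perm_fun s)) n.

Fixpoint allcodes n : seq (seq nat) :=
  if n is n'.+1 then [seq rcons w c | w <- allcodes n', c <- iota 0 n] else [:: [::]].

Lemma allcodesS n :
  allcodes n.+1 = [seq rcons w c | w <- allcodes n, c <- iota 0 n.+1].
Proof. by []. Qed.

Lemma size_allcodes n : size (allcodes n) = n`!.
Proof.
by elim: n => // n IH; rewrite allcodesS size_allpairs IH size_iota factS mulnC.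
Qed.

Lemma size_mem_allcodes n w : w \in allcodes n -> size w = n.
Proof.
elim: n w => [|n IH] w; first by rewrite inE => /eqP ->.
by rewrite allcodesS; case/allpairsP => -[u c] [/= /IH <- _ ->]; rewrite size_rcons.
Qed.

Lemma mem_allcodes g n : mkseq (lehmer g) n \in allcodes n.
Proof.
elim: n => // n IH; rewrite allcodesS mkseqS; apply/allpairsP.
by exists (mkseq (lehmer g) n, lehmer g n); split=> //; rewrite mem_iota /= add0n ltnS lehmer_le.
Qed.

(* The code of a prefix determines the relative order of its entries. *)
Lemma code_inj n : injective (@code n).
Proof.
move=> s t est.
have ec p : p < n -> lehmer (perm_fun s) p = lehmer (perm_fun t) p.
  by move=> pn; have := congr1 (fun w => nth 0 w p) est; rewrite /= !nth_mkseq.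
have key p : p <= n -> forall i j, i < p -> j < p ->
    (perm_fun s i < perm_fun s j) = (perm_fun t i < perm_fun t j).
  elim: p => // p IH pn.
  have new i : i < p -> (perm_fun s i < perm_fun s p) = (perm_fun t i < perm_fun t p).
    move=> ip; rewrite !lehmer_rank ?ec //; try exact: perm_fun_inj.
    congr (_ < _); apply: eq_in_count => y; rewrite mem_iota => /andP[_ yp].
    by apply: IH => //; lia.
  move=> i j; rewrite !ltnS leq_eqVlt => /orP[/eqP->|ip]; rewrite leq_eqVlt => /orP[/eqP->|jp].
  - by rewrite !ltnn.
  - have neq (u : 'S_n) : perm_fun u p <> perm_fun u j.
      by move=> /perm_fun_inj e; move: jp; rewrite e ltnn.
    by move: (new j jp) (neq s) (neq t); lia.
  - exact: new.
  - by apply: IH => //; lia.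
(* A value of a permutation is the number of smaller values, so the relative order recovers the
   permutation. *)
have val_rank (u : 'S_n) (i : 'I_n) : \sum_(j < n) (u j < u i) = u i :> nat.
  rewrite -(reindex_inj (@perm_inj _ u) (op := addn) (P := xpredT)
    (F := fun j : 'I_n => (j < u i) : nat)) /=.
  rewrite -(big_mkord xpredT (fun j => nat_of_bool (j < u i))).
  rewrite (big_cat_nat (n := u i)) //=; last exact: ltnW.
  rewrite big_nat (eq_bigr (fun _ => 1)) => [|j /andP[_ ->] //].
  rewrite -big_nat sum_nat_const_nat subn0 muln1 big_nat big1 ?addn0 // => j /andP[le _].
  by rewrite ltnNge le.
apply/permP => i; apply: val_inj; rewrite /= -(val_rank s) -(val_rank t).
by apply: eq_bigr => j _; have := key n (leqnn n) j i (ltn_ord j) (ltn_ord i);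
  rewrite !perm_funE => ->.
Qed.

(** The codes are [n!] distinct members of a list of length [n!], so they exhaust it; this also
    shows that [allcodes n] has no repetition. *)
Lemma perm_code n : perm_eq [seq code s | s <- enum {: 'S_n}] (allcodes n).
Proof.
have u : uniq [seq code s | s <- enum {: 'S_n}].
  by rewrite map_inj_uniq ?enum_uniq //; exact: code_inj.
have sub : {subset [seq code s | s <- enum {: 'S_n}] <= allcodes n}.
  by move=> w /mapP[s _ ->]; exact: mem_allcodes.
have le : size (allcodes n) <= size [seq code s | s <- enum {: 'S_n}].
  by rewrite size_allcodes size_map -cardE card_Sn.
apply: uniq_perm => //; first exact: leq_size_uniq le.
by have [] := uniq_min_size u sub le.
Qed.

Lemma card_code n (P : pred (seq nat)) :
  #|[set s : 'S_n | P (code s)]| = \sum_(w <- allcodes n) P w.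
Proof.
rewrite -(perm_big _ (perm_code n)) /= big_map big_enum /= -sum1dep_card.
by rewrite big_mkcond; apply: eq_bigr => s _; case: (P _).
Qed.

(** * Automata and their counts *)

(** [None] is the absorbing rejecting state. *)
Definition state := option (nat * nat).

(* A state [Some (k, z)] records [k] contacts and [z] minima since the last
   non-minimum. *)
Definition pstep m (st : state) (c : nat) : state :=
  if st is Some (k, z) then
    if c == 0 then Some (k, z.+1)
    else if c <= z then (if (k == 0) || (k == m) then Some (k, 0) else None)
    else if (c == z.+1) && (k < m) && ((k.+1 == m) || (0 < z)) then Some (k.+1, 0)
    else None
  else None.

(* A state [Some (k, a)] records [k] letters 2 and the last letter [a]. *)
Definition sstep m (st : state) (c : nat) : state :=
  if st is Some (k, a) then
    if c == 0 then (if (k == 0) || (k == m) then Some (k, 0) else None)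
    else if c == 1 then Some (k, 1)
    else if (c == 2) && (a == 1) && (k < m) then Some (k.+1, 2)
    else None
  else None.

(** The initial pair suits both automata: for [sstep] the second 0 is a dummy last letter, which
    does not allow a 2. *)
Definition run (step : state -> nat -> state) := foldl step (Some (0, 0)).

Definition accepts m (st : state) := if st is Some (k, _) then k == m else false.

(** General weights on the final state are allowed because the recurrences involve sums of [z]. *)
Definition wsum step (f : state -> nat) n := \sum_(w <- allcodes n) f (run step w).

Lemma wsumS step f n :
  wsum step f n.+1 = \sum_(w <- allcodes n) \sum_(0 <= c < n.+1) f (step (run step w) c).
Proof.
rewrite /wsum allcodesS big_allpairs_dep; apply: eq_bigr => w _.
by rewrite /index_iota subn0; apply: eq_bigr => c _; rewrite /run foldl_rcons.
Qed.

Lemma wsum0 step f : wsum step f 0 = f (Some (0, 0)).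
Proof. by rewrite /wsum /= big_seq1. Qed.

Section Counting.
Variable m : nat.

Lemma run_pstep_le w k z : run (pstep m) w = Some (k, z) ->
  [&& z <= size w, k <= m & (0 < k) ==> (z < size w)].
Proof.
elim/last_ind: w k z => [|w c IH] k z; first by move=> [<- <-].
rewrite /run foldl_rcons size_rcons -/(run _ _).
case: (run _ w) IH => [[k' z'] /(_ _ _ erefl) le|//] /=.
by do ![case: ifP => // ?] => -[<- <-] //; lia.
Qed.

Lemma run_sstep_le w k a : run (sstep m) w = Some (k, a) -> (k <= m).
Proof.
elim/last_ind: w k a => [|w c IH] k a; first by move=> [<- _].
rewrite /run foldl_rcons -/(run _ _).
case: (run _ w) IH => [[k' z'] /(_ _ _ erefl) le|//] /=.
by do ![case: ifP => // ?] => -[<- _] //; lia.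
Qed.

(** The letters split into 0, the [z] letters from 1 to [z], the contact letter [z.+1], which is
    available only if [z < n], and larger letters, all rejected. *)
Lemma sum_pstep (f : state -> nat) n k z : f None = 0 -> z <= n ->
  \sum_(0 <= c < n.+1) f (pstep m (Some (k, z)) c) =
  f (Some (k, z.+1)) + ((k == 0) || (k == m)) * z * f (Some (k, 0)) +
  [&& z < n, k < m & (k.+1 == m) || (0 < z)] * f (Some (k.+1, 0)).
Proof.
move=> f0 zn; rewrite big_nat_recl // -addnA; congr (_ + _).
rewrite (big_cat_nat (n := z)) //=; congr (_ + _).
  rewrite (eq_big_nat _ _ (F2 := fun _ => ((k == 0) || (k == m)) * f (Some (k, 0)))).
    by rewrite sum_nat_const_nat subn0; lia.
  by move=> c /andP[_ cz]; rewrite cz; case: ifP; rewrite ?f0; lia.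
case: (ltnP z n) => zn'; last by rewrite big_geq ?mul0n.
rewrite big_ltn // ltnn eqxx big_nat big1 ?addn0 => [|c /andP[zc _]].
  by case: ifP; rewrite ?f0; lia.
by rewrite ltnNge (ltnW zc) /= eqSS (gtn_eqF zc) f0.
Qed.

Lemma sum_sstep (f : state -> nat) n k a : f None = 0 ->
  \sum_(0 <= c < n.+1) f (sstep m (Some (k, a)) c) =
  ((k == 0) || (k == m)) * f (Some (k, 0)) + (0 < n) * f (Some (k, 1)) +
  [&& 1 < n, a == 1 & k < m] * f (Some (k.+1, 2)).
Proof.
move=> f0; rewrite big_nat_recl //=.
have -> : f (if (k == 0) || (k == m) then Some (k, 0) else None) =
    ((k == 0) || (k == m)) * f (Some (k, 0)) by case: ifP; rewrite ?f0; lia.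
case: n => [|n]; first by rewrite big_geq //; lia.
rewrite big_nat_recl //=; case: n => [|n]; first by rewrite big_geq //; lia.
rewrite big_nat_recl //= big1 //.
by case: ifP; rewrite ?f0; lia.
Qed.

(** Pulling a weight back along one transition turns each recurrence into an identity on single
    states, to be checked only within the bounds of [run_pstep_le]. *)
Lemma wsum_pstepS (f h : state -> nat) n : f None = 0 -> h None = 0 ->
    (forall k z, z <= n -> k <= m -> (0 < k) ==> (z < n) ->
      f (Some (k, z.+1)) + ((k == 0) || (k == m)) * z * f (Some (k, 0)) +
      [&& z < n, k < m & (k.+1 == m) || (0 < z)] * f (Some (k.+1, 0)) =
      h (Some (k, z))) ->
  wsum (pstep m) f n.+1 = wsum (pstep m) h n.
Proof.
move=> f0 h0 H; rewrite wsumS /wsum; apply: eq_big_seq => w /size_mem_allcodes sw.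
case E : (run _ w) => [[k z]|]; last by rewrite h0 big1.
by have /and3P[zn km kz] := run_pstep_le E; rewrite sum_pstep ?H // -sw.
Qed.

(** For [n <= 1] the only codes are the empty one and the single letter 0, both in state
    [(0, 0)]. *)
Lemma wsum_sstepS (f h : state -> nat) n : f None = 0 -> h None = 0 ->
    (forall k a, k <= m -> (n <= 1 -> k = 0 /\ a = 0) ->
      ((k == 0) || (k == m)) * f (Some (k, 0)) + (0 < n) * f (Some (k, 1)) +
      [&& 1 < n, a == 1 & k < m] * f (Some (k.+1, 2)) = h (Some (k, a))) ->
  wsum (sstep m) f n.+1 = wsum (sstep m) h n.
Proof.
move=> f0 h0 H; rewrite wsumS /wsum; apply: eq_big_seq => w wn.
case E : (run _ w) => [[k a]|]; last by rewrite h0 big1.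
rewrite sum_sstep // H //; first exact: run_sstep_le E.
move=> n1; suff : Some (k, a) = Some (0, 0) by case=> -> ->.
rewrite -{}E; case: n n1 wn {H} => [|[|n]] // _; rewrite inE.
  by move/eqP->.
by move=> /eqP ->.
Qed.

Lemma wsumD step (f h : state -> nat) n :
  wsum step (fun st => f st + h st) n = wsum step f n + wsum step h n.
Proof. exact: big_split. Qed.

Hypothesis m_gt0 : 0 < m.

(* Codes counted by final state: [pN] by phase [k] once a non-minimum has been read,
   [pE] before that, [pY] those of [pN] with [0 < z], [pZ] weighted by [z];
   [sU] by phase, [sA] those of [sU] ending in the letter 1. *)
Let ph (P : nat -> nat -> nat) (st : state) := if st is Some (k, z) then P k z else 0.
Let pN k n := wsum (pstep m) (ph (fun j z => (j == k) && ((0 < k) || (z < n)))) n.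
Let pY k n := wsum (pstep m) (ph (fun j z => [&& j == k, 0 < z & (0 < k) || (z < n)])) n.
Let pZ k n := wsum (pstep m) (ph (fun j z => (j == k) * z)) n.
Let pE n := wsum (pstep m) (ph (fun j z => (j == 0) && (z == n))) n.
Let sU k n := wsum (sstep m) (ph (fun j _ => j == k)) n.
Let sA k n := wsum (sstep m) (ph (fun j a => (j == k) && (a == 1))) n.

(** Only the all-zero code is counted. *)
Let pE1 n : pE n = 1.
Proof.
elim: n => [|n IH]; first by rewrite /pE wsum0.
by rewrite -IH; apply: wsum_pstepS => // k z /=; nia.
Qed.

Let pN0S n : pN 0 n.+1 + 1 = pN 0 n + 1 + pZ 0 n.
Proof.
rewrite -{1}(pE1 n.+1) -(pE1 n) /pN /pE /pZ -!wsumD; apply: wsum_pstepS => // k z /=.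
by case: eqP => [->|] /=; lia.
Qed.

Let pZ0S n : pZ 0 n.+1 = pN 0 n + 1 + pZ 0 n.
Proof.
rewrite -(pE1 n) /pN /pE /pZ -!wsumD; apply: wsum_pstepS => // k z /=.
by case: eqP => [->|] /=; lia.
Qed.

(** The last letter has to be 0, since all other letters reset [z]. *)
Let pYS k n : k < m -> pY k n.+1 = pN k n.
Proof. by move=> km; apply: wsum_pstepS => // j z /=; lia. Qed.

(** In an intermediate phase only the letter 0 keeps [k], and a contact that is not the last
    requires [0 < z]. *)
Let pNS k n : k.+1 < m -> pN k.+1 n.+1 = pN k.+1 n + pY k n.
Proof.
move=> km; rewrite /pN /pY -!wsumD; apply: wsum_pstepS => // j z /=.
case: (eqVneq j k.+1) => [->|jk] /=; last by rewrite muln0; lia.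
by rewrite (ltn_eqF km) /= mul0n; lia.
Qed.

(** The last contact is exempt from [0 < z], hence [pN] and not [pY] in the last term. *)
Let pNmS n : pN m n.+1 = pN m n + pZ m n + pN m.-1 n.
Proof.
by rewrite /pN /pZ -!wsumD; apply: wsum_pstepS => // j z /=;
  case: (eqVneq j m) => [->|jm]; rewrite ?orbT /=; case: z; nia.
Qed.

Let pZmS n : pZ m n.+1 = pZ m n + pN m n.
Proof.
by rewrite /pN /pZ -!wsumD; apply: wsum_pstepS => // j z /=;
  case: (eqVneq j m) => [->|jm]; rewrite ?orbT /=; case: z; nia.
Qed.

Let sU0S n : sU 0 n.+1 = sU 0 n + (0 < n) * sU 0 n.
Proof.
case: n => [|n].
  by rewrite addn0; apply: wsum_sstepS => // j z /=; lia.
by rewrite mul1n /sU -!wsumD; apply: wsum_sstepS => // j z /=; lia.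
Qed.

Let sA0S n : sA 0 n.+1 = (0 < n) * sU 0 n.
Proof.
case: n => [|n]; last by rewrite mul1n; apply: wsum_sstepS => // j z /=; lia.
by rewrite /sA wsumS big_seq1 big_nat1.
Qed.

Let sAS k n : 0 < k -> sA k n.+1 = sU k n.
Proof. by move=> k0; apply: wsum_sstepS => // j z /=; lia. Qed.

Let sUS k n : k.+1 < m -> sU k.+1 n.+1 = sU k.+1 n + sA k n.
Proof.
by move=> km; rewrite /sU /sA -wsumD; apply: wsum_sstepS => // j z /=; lia.
Qed.

Let sUmS n : sU m n.+1 = sU m n + sU m n + sA m.-1 n.
Proof.
by rewrite /sU /sA -!wsumD; apply: wsum_sstepS => // j z /=; lia.
Qed.

Let zero0 k : [/\ pN k 0 = 0, pY k 0 = 0, sA k 0 = 0 & 0 < k -> sU k 0 = 0 /\ pZ k 0 = 0].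
Proof. by rewrite /pN /pY /sA /sU /pZ !wsum0 /=; split; lia. Qed.

(** For [k = 0] the quantities [pN 0 n + 1], [pZ 0 n] and [sU 0 n] coincide and double from length 1
    on. For a later phase the claim reduces to [pY k n = sU k.+1 n], whose two sides have equal
    increments by the claim for the preceding phase. *)
Let pN_sA k n : k < m -> pN k n.+1 = pN k n + sA k n.+1.
Proof.
elim: k n => [|k IH] n km.
  have [pN00 _ _ _] := zero0 0.
  have pZ00 : pZ 0 0 = 0 by rewrite /pZ wsum0.
  have sU00 : sU 0 0 = 1 by rewrite /sU wsum0.
  have pU i : sU 0 i.+1 = pN 0 i.+1 + 1 /\ sU 0 i.+1 = pZ 0 i.+1.
    elim: i => [|i IHi]; first by have := sU0S 0; have := pN0S 0; have := pZ0S 0; lia.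
    have := sU0S i.+1; have := pN0S i.+1; have := pZ0S i.+1; lia.
  rewrite sA0S; have := pN0S n; case: n => [|n]; first by lia.
  by have := pU n; lia.
have km' : k < m by lia.
rewrite pNS //; congr (_ + _).
elim: n => [|n IHn].
  by rewrite sAS //; have [_ -> _ _] := zero0 k; have [_ _ _ [//|-> _]] := zero0 k.+1.
rewrite sAS // sUS // -sAS // -IHn pYS //.
case: n {IHn} => [|n]; last by rewrite pYS // -IH.
by have [-> -> -> _] := zero0 k.
Qed.

Lemma count_path_star n :
  wsum (pstep m) (accepts m) n = wsum (sstep m) (accepts m) n.
Proof.
have -> : wsum (pstep m) (accepts m) n = pN m n.
  by apply: eq_bigr => w _; case: (run _ _) => [[k z]|] //=; rewrite m_gt0 andbT.
have -> : wsum (sstep m) (accepts m) n = sU m n.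
  by apply: eq_bigr => w _; case: (run _ _) => [[k z]|].
(* The second equation strengthens the induction: it gives [pN m] the doubling recurrence of [sU m],
   and [pN_sA] at [m.-1] propagates it. *)
suff [] : pN m n = sU m n /\ pZ m n + pN m.-1 n = sU m n + sA m.-1 n by [].
have pm : m.-1 < m by lia.
elim: n => [|n [IH1 IH2]].
  have [-> _ _ [//|-> ->]] := zero0 m.
  by have [-> _ -> _] := zero0 m.-1.
have := pNmS n; have := pZmS n; have := sUmS n; have := pN_sA n pm; lia.
Qed.

End Counting.

(** * Paths and avoidance of 123 *)

(* The features of "a path or a star on [N] vertices, plus isolated vertices" that
   exclude the rejecting transitions of the automata. *)
Record component n N (com : nat -> nat -> nat) : Prop := Component {
  comp_le1 : forall u v, u < n -> v < n -> u != v -> com u v <= 1;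
  comp_triangle : forall u v w, u < v -> v < w -> w < n ->
    0 < com u v -> 0 < com v w -> 0 < com u w -> False;
  comp_cut : forall p, (forall u v, u < p -> p <= v -> v < n -> com u v = 0) ->
    forall u0 v0, u0 < v0 -> v0 < p -> v0 < n -> 0 < com u0 v0 ->
    forall u v, u < n -> v < n -> u != v -> 0 < com u v -> u < p;
  comp_upper : forall L, uniq L ->
    (forall u, u \in L -> u < n /\ exists2 v, v < n & (u != v) && (0 < com u v)) ->
    size L <= N;
  comp_lower : forall L,
    (forall u v, u < n -> v < n -> u != v -> 0 < com u v -> u \in L) -> N <= size L
}.

Lemma uniq_count_le (T : eqType) (a : pred T) (s L : seq T) :
  uniq L -> {subset L <= s} -> all a L -> size L <= count a s.
Proof.
move=> uL sub /allP al; rewrite -size_filter; apply: uniq_leq_size => // x xL.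
by rewrite mem_filter al // sub.
Qed.

Lemma count1P (T : eqType) (a : pred T) (s : seq T) : uniq s -> count a s = 1 ->
  exists2 x, x \in s & forall y, y \in s -> a y = (y == x).
Proof.
move=> us; rewrite -size_filter => c1.
case E : (filter a s) c1 => [|x [|//]] // _.
have me y : (y \in filter a s) = (y == x) by rewrite E inE.
exists x; first by have := me x; rewrite eqxx mem_filter => /andP[].
by move=> y ys; rewrite -me mem_filter ys andbT.
Qed.

Lemma count_eq1 (T : eqType) (a : pred T) (s : seq T) x : uniq s -> x \in s ->
  (forall y, y \in s -> a y = (y == x)) -> count a s = 1.
Proof.
by move=> us xs ay; rewrite (eq_in_count ay) count_uniq_mem // xs.
Qed.

Lemma count_gt1P (T : eqType) (a : pred T) (s : seq T) : uniq s -> 1 < count a s ->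
  exists x y, [/\ x \in s, y \in s, a x, a y & x != y].
Proof.
move=> us; rewrite -size_filter.
have: uniq (filter a s) by rewrite filter_uniq.
case E : (filter a s) => [|x [|y l]] //=; rewrite inE negb_or => /andP[/andP[xy _] _] _.
have: x \in filter a s by rewrite E mem_head.
have: y \in filter a s by rewrite E !inE eqxx orbT.
by rewrite !mem_filter => /andP[? ?] /andP[? ?]; exists x, y.
Qed.

Section Path.
Variables (m : nat) (g : nat -> nat).
Hypothesis gI : injective g.

Let gneq x y : x != y -> g x != g y.
Proof. by apply: contra_neq => /gI. Qed.

(** The weight of the pair in the competition graph; out-neighbours lie to the left and below. *)
Definition common_below u v :=
  count (fun x => (g x < g u) && (g x < g v)) (iota 0 (minn u v)).

Lemma common_belowC u v : common_below u v = common_below v u.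
Proof. by rewrite /common_below minnC; apply: eq_count => x; rewrite andbC. Qed.

Lemma common_below_gt0P u v : u < v ->
  reflect (exists x, [/\ x < u, g x < g u & g x < g v]) (0 < common_below u v).
Proof.
move=> uv; rewrite /common_below -has_count.
apply: (iffP hasP) => [[x]|[x [? ? ?]]]; last by exists x; rewrite ?mem_iota; lia.
by rewrite mem_iota => ? ?; exists x; split; lia.
Qed.

(** * Smaller predecessors of a position that follows a run of left-to-right minima *)

Section Trailing.
Variables p z : nat.
Hypotheses (zp : z <= p) (z0 : forall i, p - z <= i -> i < p -> lehmer g i = 0).

Let lo := count (fun i => g i < g p) (iota 0 (p - z)).
Let hi := count (fun i => g i < g p) (iota (p - z) z).

Let lehmer_split : lehmer g p = lo + hi.
Proof.
have e : iota 0 p = iota 0 (p - z) ++ iota (p - z) z by rewrite -iotaD subnK.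
by rewrite /lehmer e count_cat.
Qed.

Let hi_le : hi <= z.
Proof. by rewrite -[X in _ <= X](size_iota (p - z) z) count_size. Qed.

Let zlt i x : p - z <= i -> i < p -> x < i -> g i < g x.
Proof.
move=> zi ip xi; have /eqP/lehmer0P/(_ x xi) := z0 zi ip.
have : g i != g x by apply: gneq; lia.
by lia.
Qed.

Let hi_full x : x < p - z -> g x < g p -> hi = z.
Proof.
move=> xz gx; rewrite -[RHS](size_iota (p - z) z); apply/eqP; rewrite -all_count.
apply/allP => i; rewrite mem_iota => ?; have := @zlt i x; lia.
Qed.

(** A smaller entry left of the run would force all [z] minima of the run below [g p] as well, hence
    [z + 1] smaller entries. *)
Lemma below_short x : lehmer g p <= z -> x < p -> g x < g p -> p - z <= x.
Proof.
move=> cz xp gx; rewrite leqNgt; apply/negP => xz.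
have := lehmer_split; rewrite (hi_full xz gx).
suff : 0 < lo by lia.
by rewrite -has_count; apply/hasP; exists x; rewrite ?mem_iota; lia.
Qed.

Lemma below_touch : lehmer g p = z.+1 -> exists2 x0, x0 < p - z &
  forall x, x < p -> (g x < g p) = (p - z <= x) || (x == x0).
Proof.
move=> cz; have := lehmer_split => sp.
have : 0 < lo by lia.
rewrite -has_count => /hasP[x]; rewrite mem_iota => /andP[_ xz] gx.
have hz := hi_full xz gx; have lo1 : lo = 1 by lia.
have [|x0 x0p ax] := count1P _ lo1; first exact: iota_uniq.
move: x0p; rewrite mem_iota => /andP[_ x0p]; exists x0 => // y yp.
case: (leqP (p - z) y) => yz /=; last by apply: ax; rewrite mem_iota.
by apply/idP; have := @zlt y x; lia.
Qed.

Lemma below_many : z.+1 < lehmer g p ->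
  exists x y, [/\ x < p - z, y < p - z, g x < g p, g y < g p & x != y].
Proof.
move=> cz; have lo2 : 1 < lo by have := lehmer_split; lia.
have [|x [y []]] := count_gt1P _ lo2; first exact: iota_uniq.
by rewrite !mem_iota => ? ? ? ? ?; exists x, y; split.
Qed.

End Trailing.

(** Invariant of [pstep] after [p] letters. If [0 < k], the path is [h 0, ..., h k] from left to
    right; if [k = 0], there is no edge and [h] is arbitrary. The last non-minimum, if any, is
    [p - z.+1]. By [pi_min], the least entry before it lies under no earlier non-minimum, so that
    the next contact creates only one edge. *)
Record path_inv p k z (h : nat -> nat) : Prop := PathInv {
  pi_le : k <= m;
  pi_zp : z <= p;
  pi_zeros : forall i, p - z <= i -> i < p -> lehmer g i = 0;
  pi_last : z < p -> 0 < lehmer g (p - z.+1);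
  pi_avoid : forall x v, v < p -> x < v -> g x < g v -> lehmer g x = 0;
  pi_mono : forall i, i < k -> h i < h i.+1;
  pi_lt : forall i, 0 < k -> i <= k -> h i < p;
  pi_edge : forall i, i < k -> common_below (h i) (h i.+1) = 1;
  pi_edges : forall u v, u < v -> v < p -> 0 < common_below u v ->
    exists i, [/\ i < k, u = h i & v = h i.+1];
  pi_min : k < m -> z < p -> forall x y, x < y -> y < p - z.+1 -> g x < g y ->
    exists2 x', x' < p - z.+1 & g x' < g x;
  pi_end : 0 < k -> k < m -> z < p /\ h k = p - z.+1
}.

Lemma path_inv0 h : path_inv 0 0 0 h.
Proof. by split. Qed.

(** Besides the run of minima, only the least earlier entry [x0] lies below [p]. Minima of the run
    are shared with no earlier vertex, and [pi_min] prevents vertices before [p - z.+1] from sharing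
    [x0]. *)
Lemma touch_unique p k z h : path_inv p k z h -> k < m -> lehmer g p = z.+1 ->
  z < p /\ forall u, u < p -> (0 < common_below u p) = (u == p - z.+1).
Proof.
move=> [_ zp z0 last av _ _ _ _ minP _] km c.
have zp' : z < p by have := lehmer_le g p; lia.
split=> // u up; have [x0 x0p below] := below_touch zp z0 c.
have [w wu gw] := lehmer_gt0P _ _ (last zp').
have x0min x : x < p - z -> x != x0 -> g x0 < g x.
  move=> xz xx0; have xp : x < p by lia.
  have x0p' : x0 < p by lia.
  by have := below x xp; have := below x0 x0p'; lia.
have x0u : x0 != p - z.+1.
  apply/eqP => e; have wz : w < p - z by lia.
  have wx0 : w != x0 by lia.
  by have := x0min w wz wx0; rewrite e; lia.
apply/common_below_gt0P/eqP => // [[x [xu gxu gxp]]|->]; last first.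
  exists x0; split; first by lia.
  - by apply: x0min; lia.
  - by rewrite below; lia.
have uz : u < p - z.
  rewrite ltnNge; apply/negP => uz.
  by have /eqP/lehmer0P/(_ x xu) := z0 u uz up; lia.
have ex : x = x0 by have := below x (ltn_trans xu up); lia.
apply/eqP; rewrite eqn_leq; apply/andP; split; first by lia.
rewrite leqNgt; apply/negP => uu.
have [x' x'p gx'] := minP km zp' x u xu uu gxu.
have : x' != x0 by apply: contraTneq gx' => ->; rewrite ex; lia.
by move/x0min; rewrite -ex; lia.
Qed.

(** A new minimum has no out-neighbour, so no edge appears. *)
Lemma path_inv_zero p k z h :
  path_inv p k z h -> lehmer g p = 0 -> path_inv p.+1 k z.+1 h.
Proof.
move=> [km zp z0 last av mono lt edge edges minP endP] c.
have /eqP/lehmer0P np := c.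
split; rewrite ?subSS //; first by move=> i zi ip; case: (eqVneq i p) => [->|ne] //; apply: z0; lia.
- move=> x v vp xv gx; case: (eqVneq v p) => [e|ne]; last by apply: (av x v); lia.
  by subst v; have := np x; lia.
- by move=> i k0 ik; have := lt i k0 ik; lia.
- move=> u v uv vp c0; case: (eqVneq v p) => [e|ne]; last by apply: edges; lia.
  by move: c0 => /(common_below_gt0P uv)[x [xu _ gx]]; have := np x; subst v; lia.
Qed.

(* [p.-1] is then a left-to-right minimum to the right of [y]. *)
Let min_step p z : z <= p -> (forall i, p - z <= i -> i < p -> lehmer g i = 0) ->
  0 < z -> forall x y, x < y -> y < p -> g x < g y -> exists2 x', x' < p & g x' < g x.
Proof.
move=> zp z0 zgt x y xy yp gxy; exists p.-1; first by lia.
have /eqP/lehmer0P np : lehmer g p.-1 = 0 by apply: z0; lia.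
have xp : x != p.-1 by lia.
have := np x; have := gneq xp; have : x < p.-1 by lia.
by lia.
Qed.

(** All out-neighbours of [p] are in the run of minima, and no earlier non-minimum stands to their
    right, so no edge appears. *)
Lemma path_inv_short p k z h : path_inv p k z h ->
  0 < lehmer g p <= z -> (k == 0) || (k == m) -> path_inv p.+1 k 0 h.
Proof.
move=> [km zp z0 last av mono lt edge edges minP endP] /andP[c0 cz] k0m.
have short x := below_short zp z0 (x := x) cz.
split; rewrite ?subn0 ?subn1 //=.
- by move=> i; lia.
- move=> x v vp xv gx; case: (eqVneq v p) => [e|ne]; last by apply: (av x v); lia.
  by apply: z0; have := short x; subst v; lia.
- by move=> i k0 ik; have := lt i k0 ik; lia.
- move=> u v uv vp cc; case: (eqVneq v p) => [e|ne]; last by apply: edges; lia.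
  move: cc => /(common_below_gt0P uv)[x [xu gxu gx]]; subst v.
  have zx : p - z <= x by apply: short => //; lia.
  have /eqP/lehmer0P/(_ x xu) : lehmer g u = 0 by apply: z0; lia.
  by lia.
- by move=> _ _; apply: min_step zp z0 _; lia.
- by move=> k0 km'; lia.
Qed.

Lemma path_inv_touch p k z h : path_inv p k z h -> lehmer g p = z.+1 -> k < m ->
  (k.+1 == m) || (0 < z) ->
  path_inv p.+1 k.+1 0 (fun i => if i < k then h i else if i == k then p - z.+1 else p).
Proof.
move=> inv c klm kz; have [zp' uniqp] := touch_unique inv klm c.
move: inv => [km zp z0 last av mono lt edge edges minP endP].
have [x0 x0p below] := below_touch zp z0 c.
have x0min x : x < p - z -> x != x0 -> g x0 < g x.
  move=> xz xx0; have xp : x < p by lia.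
  have x0p' : x0 < p by lia.
  by have := below x xp; have := below x0 x0p'; lia.
(* Entry [k] is set explicitly to start the path when [k = 0]; when [0 < k] it agrees with [h k] by
   [pi_end]. *)
set h' := fun i => _.
have hk : h' k = p - z.+1 by rewrite /h' ltnn eqxx.
have hk1 : h' k.+1 = p by rewrite /h' ltnNge leqnSn /= gtn_eqF.
have hE i : i <= k -> 0 < k -> h' i = h i.
  by rewrite /h' => ik k0; have [_ e] := endP k0 klm; case: ltngtP ik => // ->.
split; rewrite ?subn0 ?subn1 //=.
- by move=> i; lia.
- by move=> _; rewrite c.
- move=> x v vp xv gx; case: (eqVneq v p) => [e|ne]; last by apply: (av x v); lia.
  subst v; move: gx; rewrite below // => /orP[zx|/eqP ->]; first exact: z0.
  by apply/eqP/lehmer0P => y y0; apply/ltnW/x0min; lia.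
- move=> i; rewrite ltnS leq_eqVlt => /orP[/eqP ->|ik]; first by rewrite hk hk1; lia.
  by rewrite !hE ?mono //; lia.
- move=> i _; rewrite leq_eqVlt => /orP[/eqP ->|ik]; first by rewrite hk1.
  case: (posnP k) => [k0|k0]; last by rewrite hE //; have := @lt i k0; lia.
  have -> : i = k by lia.
  by rewrite hk; lia.
- move=> i; rewrite ltnS leq_eqVlt => /orP[/eqP ->|ik]; last by rewrite !hE ?edge //; lia.
  rewrite hk hk1.
  have x0u : x0 < p - z.+1.
    have : 0 < common_below (p - z.+1) p by rewrite uniqp; lia.
    move=> /(common_below_gt0P _) H; have [|x [xu _ gx]] := H; first by lia.
    by have := below x; lia.
  apply: (@count_eq1 _ _ _ x0); rewrite ?iota_uniq ?mem_iota //; first by lia.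
  move=> y; rewrite mem_iota => /andP[_ yu]; rewrite below; last by lia.
  have -> : (p - z <= y) = false by lia.
  case: eqVneq => [->|_] /=; last by rewrite andbF.
  by rewrite andbT x0min //; lia.
- move=> u v uv vp cc; case: (eqVneq v p) => [e|ne].
    by subst v; exists k; rewrite hk hk1; split=> //; apply/eqP; rewrite -uniqp.
  have [|i [ik -> ->]] := edges u v uv _ cc; first by lia.
  have k0 : 0 < k by lia.
  by exists i; rewrite !hE ?(ltnW ik) //; split=> //; lia.
- by move=> k1m _; apply: min_step zp z0 _; lia.
Qed.

Definition rstate step p := run step (mkseq (lehmer g) p).

Lemma rstateS step p : rstate step p.+1 = step (rstate step p) (lehmer g p).
Proof. by rewrite /rstate mkseqS /run foldl_rcons. Qed.

Lemma run_path_inv p k z : rstate (pstep m) p = Some (k, z) -> exists h, path_inv p k z h.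
Proof.
elim: p k z => [|p IH] k z; first by move=> [<- <-]; exists id; exact: path_inv0.
rewrite rstateS; case: (rstate _ p) IH => [[k' z'] /(_ _ _ erefl)[h inv]|//] /=.
case: eqP => [c0 [<- <-]|/eqP c0]; first by exists h; exact: path_inv_zero.
case: (leqP (lehmer g p) z') => [cz|cz] /=.
  case: ifP => // kk [<- <-].
  by exists h; apply: path_inv_short inv _ kk; lia.
case: ifP => // /andP[/andP[/eqP c klm] kz] [<- <-].
by eexists; exact: path_inv_touch inv c klm kz.
Qed.

(** * Completeness for paths: every rejected letter contradicts the shape of the graph *)

Section Complete.
Variable n : nat.
Hypotheses (m_gt0 : 0 < m) (comp : component n m.+1 common_below)
  (av : forall x y w, x < y -> y < w -> w < n -> g x < g y -> g y < g w -> False).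

Let in_path p k z h u v : path_inv p k z h -> u < p -> v < p -> u != v ->
  0 < common_below u v -> u \in mkseq h k.+1.
Proof.
move=> inv up vp; rewrite neq_ltn => /orP[uv|vu].
  by case/(pi_edges inv uv vp) => i [ik -> _]; apply/mapP; exists i; rewrite ?mem_iota; lia.
rewrite common_belowC => /(pi_edges inv vu up)[i [ik _ ->]].
by apply/mapP; exists i.+1; rewrite ?mem_iota; lia.
Qed.

(** Avoidance of 123 makes the values of non-minima decrease from left to right, so [g v <= g p]. *)
Let below_mono p v x : p < v -> v < n -> 0 < lehmer g p -> g x < g v -> g x < g p.
Proof.
move=> pv vn /lehmer_gt0P[y yp gy] gx; rewrite ltnNge; apply/negP => px.
by apply: (av yp pv vn gy); lia.
Qed.

(** If no edge crosses [p], connectedness puts all edges before [p], hence on [k + 1 <= m] vertices,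
    one too few. *)
Let path_count p k z h : path_inv p k z h -> p <= n -> k < m ->
  (forall u v, u < p -> p <= v -> v < n -> common_below u v = 0) ->
  (exists u v, [/\ u < v, v < p & 0 < common_below u v]) -> False.
Proof.
move=> inv pn km cut [u0 [v0 [uv0 vp0 c0]]].
have inp u v := comp_cut comp cut uv0 vp0 (leq_trans vp0 pn) c0 (u := u) (v := v).
suff : m.+1 <= size (mkseq h k.+1) by rewrite size_mkseq; lia.
apply: (comp_lower comp) => u v un vn uv cc; apply: (in_path inv _ _ uv cc); first exact: (inp u v).
by apply: (inp v u) => //; rewrite 1?eq_sym // common_belowC.
Qed.

Lemma run_path_complete p : p <= n -> rstate (pstep m) p.
Proof.
elim: p => // p IH pn.
case E : (rstate (pstep m) p) (IH (ltnW pn)) => [[k z]|] // _.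
have [h inv] := run_path_inv E.
have [km zp z0 last _ mono lt edge edges minP endP] := inv.
rewrite rstateS E /=; case: eqP => // /eqP c0.
case: (leqP (lehmer g p) z) => [cz|cz] /=.
  case: ifP => // /negbT; rewrite negb_or => /andP[k0 kM]; exfalso.
  (* A short letter inside the path: by [below_mono], an edge across [p] would use an out-neighbour
     of [p], thus a minimum of the run, but its left end would then be a minimum itself. *)
  apply: (path_count inv (ltnW pn)); first by lia.
    move=> u v up pv vn; apply/eqP; rewrite -leqn0 leqNgt; apply/negP.
    move=> /common_below_gt0P H; have [|x [xu gxu gxv]] := H; first by lia.
    have gxp : g x < g p.
      case: (eqVneq v p) => [<- //|vp]; apply: (below_mono (v := v)); lia.
    have xz : p - z <= x by apply: below_short gxp => //; lia.
    have /eqP/lehmer0P/(_ x xu) : lehmer g u = 0 by apply: z0; lia.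
    by lia.
  by exists (h 0), (h 1); rewrite mono ?edge ?lt //; lia.
case: (ltnP z.+1 (lehmer g p)) => [c2|c1].
  (* Two entries left of the run lie below [p]. The last non-minimum exceeds [g p] by avoidance of
     123, so it shares both with [p], and the weight is at least 2. *)
  exfalso; have zp' : z < p by have := lehmer_le g p; lia.
  have [x [y [xz yz gx gy xy]]] := below_many zp c2.
  have [w wu gw] := lehmer_gt0P _ _ (last zp').
  have up : p - z.+1 < p by lia.
  have gup : g p < g (p - z.+1).
    have : ~ g (p - z.+1) < g p by move=> gu; apply: (av wu up pn gw gu).
    have : p != p - z.+1 by lia.
    by move/gneq; lia.
  have xu : x != p - z.+1 by apply: contraTneq gx => ->; lia.
  have yu : y != p - z.+1 by apply: contraTneq gy => ->; lia.
  have := comp_le1 comp (ltn_trans up pn) pn; rewrite neq_ltn up => /(_ isT).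
  have : 2 <= common_below (p - z.+1) p.
    apply: (@uniq_count_le _ _ _ [:: x; y]) => /=; first by rewrite inE xy.
      by move=> i; rewrite !inE mem_iota => /orP[]/eqP->; lia.
    by lia.
  by lia.
have c : lehmer g p = z.+1 by lia.
case: ifP => // /negbT H; exfalso.
case: (ltnP k m) => klm; last first.
  (* A contact in phase [m] makes [p] a further non-isolated vertex besides [h 0, ..., h m]. *)
  have ekm : k = m by lia.
  have zp' : z < p by have := lehmer_le g p; lia.
  have [x0 x0p below] := below_touch zp z0 c.
  have [w wu gw] := lehmer_gt0P _ _ (last zp').
  have mh i j : i < j -> j <= k -> h i < h j.
    elim: j => // j IHj; rewrite ltnS leq_eqVlt => /orP[/eqP ->|ij] jk; first exact: mono.
    by apply: ltn_trans (mono j jk); apply: IHj => //; lia.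
  suff : size (rcons (mkseq h k.+1) p) <= m.+1 by rewrite size_rcons size_mkseq; lia.
  apply: (comp_upper comp).
    rewrite rcons_uniq map_inj_in_uniq ?iota_uniq ?andbT.
      apply/mapP => -[i]; rewrite mem_iota => ik e; have := lt i; lia.
    move=> i j; rewrite !mem_iota => ik jk e.
    by case: (ltngtP i j) => // ij; have := mh _ _ ij; rewrite e; lia.
  move=> u; rewrite mem_rcons inE => /orP[/eqP ->|/mapP[i]].
    split=> //; exists (p - z.+1); first by lia.
    rewrite common_belowC; apply/andP; split; first by lia.
    apply/common_below_gt0P; first by lia.
    have gup : g p < g (p - z.+1).
      have : ~ g (p - z.+1) < g p.
        by move=> gu; apply: (av wu _ pn gw gu); lia.
      have : p != p - z.+1 by lia.
      by move/gneq; lia.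
    have gx0 : g x0 < g p by rewrite below; lia.
    have : x0 != p - z.+1 by apply: contraTneq gx0 => ->; lia.
    by exists x0; split; lia.
  rewrite mem_iota => ik ->.
  have k0 : 0 < k by lia.
  have hp j : j <= k -> h j < p by exact: lt.
  split; first by have := hp i; lia.
  case: (ltnP i k) => ik'.
    exists (h i.+1); first by have := hp i.+1; lia.
    by rewrite edge // neq_ltn mono.
  have -> : i = k.-1.+1 by lia.
  exists (h k.-1); first by have := hp k.-1; lia.
  rewrite common_belowC edge; last by lia.
  by rewrite eq_sym neq_ltn mono //; lia.
have [zp' uniqp] := touch_unique inv klm c.
have z00 : z = 0 by move: H; rewrite c eqxx klm; lia.
have k1m : k.+1 < m by move: H; rewrite c eqxx klm; lia.
have [x0 x0p below] := below_touch zp z0 c.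
have ep : p - z.+1 = p.-1 by lia.
have up : p.-1 < p by lia.
have cup : 0 < common_below p.-1 p by rewrite uniqp // ep.
have ux0 : x0 < p.-1 /\ g x0 < g p.-1.
  have [x [xu gxu gxp]] := common_below_gt0P up cup.
  have -> : x0 = x by have := below x; lia.
  by [].
(* With [z = 0], the consecutive positions [p.-1] and [p] share [x0]. An edge across [p.+1] would
   also use [x0] and close a triangle, so the path stops with [k.+1 < m] edges. *)
have cut u v : u < p.+1 -> p.+1 <= v -> v < n -> common_below u v = 0.
  move=> up' pv vn; apply/eqP; rewrite -leqn0 leqNgt; apply/negP.
  move=> /common_below_gt0P P; have [|x [xu gxu gxv]] := P; first by lia.
  have cp0 : 0 < lehmer g p by lia.
  have gxp : g x < g p by exact: below_mono pv vn cp0 gxv.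
  have ex : x = x0 by have := below x; lia.
  apply: (comp_triangle comp up (_ : p < v) vn cup) => //; apply/common_below_gt0P; try lia.
    by exists x0; split; rewrite -?ex //; lia.
  by exists x0; split; rewrite -?ex //; rewrite ?ex; lia.
have inp u v := comp_cut comp cut up (ltnSn p) pn cup (u := u) (v := v).
suff : m.+1 <= size (p.-1 :: p :: mkseq h k) by rewrite /= size_mkseq; lia.
have main u v : u < v -> v < p.+1 -> 0 < common_below u v ->
    (u \in p.-1 :: p :: mkseq h k) && (v \in p.-1 :: p :: mkseq h k).
  move=> uv vp cc; rewrite !inE; case: (eqVneq v p) => [e|ne].
    by subst v; move: cc; rewrite uniqp // ep => ->; rewrite orbT.
  have [|i [ik -> ->]] := edges u v uv _ cc; first by lia.
  have mem j : j < k -> h j \in mkseq h k.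
    by move=> jk; apply/mapP; exists j; rewrite ?mem_iota.
  rewrite mem // !orbT /=; have k0 : 0 < k by lia.
  have [_ e] := endP k0 klm.
  case: (ltnP i.+1 k) => ik'; first by rewrite mem ?orbT.
  have -> : i.+1 = k by lia.
  by rewrite e ep eqxx.
apply: (comp_lower comp) => u v un vn uv cc.
have up' := inp u v un vn uv cc.
have vp' : v < p.+1 by apply: (inp v u) => //; rewrite 1?eq_sym // common_belowC.
move: uv; rewrite neq_ltn => /orP[uv|vu]; first by have /andP[] := main u v uv vp' cc.
by rewrite common_belowC in cc; have /andP[] := main v u vu up' cc.
Qed.

Lemma path_accepts : accepts m (rstate (pstep m) n).
Proof.
case E : (rstate (pstep m) n) (run_path_complete (leqnn n)) => [[k z]|] // _ /=.
have [h inv] := run_path_inv E.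
have : m.+1 <= size (mkseq h k.+1).
  by apply: (comp_lower comp) => u v un vn uv cc; exact: in_path inv _ _ uv cc.
by rewrite size_mkseq; have := pi_le inv; lia.
Qed.

End Complete.

End Path.

(** * Stars and avoidance of 132 *)

Section Star.
Variables (m : nat) (g : nat -> nat).
Hypothesis gI : injective g.

Let gneq x y : x != y -> g x != g y.
Proof. by apply: contra_neq => /gI. Qed.

(** For the reverse-complement, out-neighbours lie to the right and above. Only those before [p]
    count, so that the weights grow as the code is read. *)
Definition common_above p u v :=
  count (fun x => [&& u < x, v < x, g u < g x & g v < g x]) (iota 0 p).

Lemma common_aboveC p u v : common_above p u v = common_above p v u.
Proof. by apply: eq_count => x; lia. Qed.

Lemma common_above_gt0P p u v :
  reflect (exists x, [/\ x < p, u < x, v < x, g u < g x & g v < g x])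
    (0 < common_above p u v).
Proof.
rewrite /common_above -has_count.
apply: (iffP hasP) => [[x]|[x [? ? ? ? ?]]]; last by exists x; rewrite ?mem_iota; lia.
by rewrite mem_iota => ? /and4P[]; exists x.
Qed.

Lemma common_aboveS p u v : common_above p.+1 u v =
  common_above p u v + [&& u < p, v < p, g u < g p & g v < g p].
Proof. by rewrite /common_above -[p.+1]addn1 iotaD count_cat /= addn0. Qed.

Lemma common_above_leq p q u v : p <= q -> common_above p u v <= common_above q u v.
Proof. by move=> /subnKC <-; rewrite /common_above iotaD count_cat leq_addr. Qed.

(** If [g p] were below [g p.-1], then [lehmer g p] would be at most 1. So [p.-1] and its only
    smaller predecessor [r] are the two entries below [p]; all others exceed [g p.-1]. *)
Lemma below_two p : lehmer g p = 2 -> lehmer g p.-1 = 1 -> exists r,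
  [/\ r < p.-1, forall x, x < p -> (g x < g p) = (x == r) || (x == p.-1)
    & forall x, x < p -> x != r -> g r < g x].
Proof.
move=> c2 c1; have p2 : 1 < p by have := lehmer_le g p; lia.
have [|r rq br] := count1P _ c1; first exact: iota_uniq.
move: rq; rewrite mem_iota => /andP[_ rq].
have brq x : x < p.-1 -> (g x < g p.-1) = (x == r) by move=> xq; rewrite br ?mem_iota.
have gr : g r < g p.-1 by rewrite brq.
have ep : iota 0 p = rcons (iota 0 p.-1) p.-1.
  by rewrite -cats1 -(iotaD 0 p.-1 1) addn1 prednK //; lia.
have gq : g p.-1 < g p.
  have : p.-1 != p by lia.
  move/gneq; case: ltngtP => // gp _; suff : lehmer g p <= 1 by lia.
  rewrite -c1 /lehmer ep -cats1 count_cat /= addn0 ltnNge (ltnW gp) addn0.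
  by apply: sub_count => x /=; lia.
have rp : r < p by lia.
have bp x : x < p -> (g x < g p) = (x == r) || (x == p.-1).
  move=> xp; case: (eqVneq x r) => [->|xr] /=; first by lia.
  case: (eqVneq x p.-1) => [->|xq] //; apply/negbTE/negP => gx.
  suff : size [:: r; p.-1; x] <= lehmer g p by rewrite c2.
  apply: uniq_count_le => /=; first by rewrite !inE; lia.
    by move=> y; rewrite !inE mem_iota; lia.
  by lia.
exists r; split=> // x xp xr.
case: (eqVneq x p.-1) => [->|xq] //.
have := brq x; have : x < p.-1 by lia.
by have := gneq xr; lia.
Qed.

(** Invariant of [sstep] after [p] letters: [R] is the centre and [h 0, ..., h k.-1] are the leaves
    from left to right. The reverse-complement of 132 is 213, which [si_avoid] excludes. While the
    star is incomplete, [si_min] keeps its centre at the least value, which forces later leaves to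
    attach to it. *)
Record star_inv p k a R (h : nat -> nat) : Prop := StarInv {
  si_le : k <= m;
  si_last : 0 < p -> lehmer g p.-1 = a;
  si_avoid : forall x y w, x < y -> y < w -> w < p -> g x < g w -> g y < g w -> g x < g y;
  si_mono : forall i j, i < j -> j < k -> h i < h j;
  si_root : forall i, i < k -> R < h i;
  si_edge : forall i, i < k -> common_above p R (h i) = 1;
  si_edges : forall u v, u < v -> 0 < common_above p u v ->
    u = R /\ exists2 i, i < k & v = h i;
  si_min : 0 < k -> k < m -> forall x, x < p -> g R <= g x
}.

Lemma star_inv0 R h : star_inv 0 0 0 R h.
Proof. by split. Qed.

Lemma star_inv_lt p k a R h i : star_inv p k a R h -> i < k -> h i < p.-1.
Proof.
move=> inv ik; have : 0 < common_above p R (h i) by rewrite (si_edge inv).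
by case/common_above_gt0P => x [? _ ? _ _]; lia.
Qed.

(** With at most one smaller predecessor, [p] is a common out-neighbour of no pair. *)
Lemma star_inv_small p k a R h : star_inv p k a R h -> lehmer g p <= 1 ->
  (lehmer g p == 0) ==> (k == 0) || (k == m) -> star_inv p.+1 k (lehmer g p) R h.
Proof.
move=> [km last av mono root edge edges minP] c1 c0.
have no2 u v : u != v -> u < p -> v < p -> g u < g p -> g v < g p -> False.
  move=> uv up vp gu gv; suff : size [:: u; v] <= lehmer g p by rewrite /=; lia.
  apply: uniq_count_le => /=; first by rewrite !inE; lia.
    by move=> y; rewrite !inE mem_iota; lia.
  by lia.
have comS u v : u != v -> common_above p.+1 u v = common_above p u v.
  move=> uv; rewrite common_aboveS; case: and4P => [[up vp gu gv]|]; last by lia.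
  by case: (no2 u v).
split=> //.
- move=> x y w xy yw wp gx gy; case: (eqVneq w p) => [e|ne]; last by apply: (av x y w); lia.
  by subst w; case: (no2 x y) => //; lia.
- by move=> i ik; rewrite comS ?edge //; have := root i ik; lia.
- by move=> u v uv; rewrite comS; [exact: edges | lia].
- move=> k0 kM x; rewrite ltnS leq_eqVlt => /orP[/eqP->|]; last exact: minP.
  have /lehmer_gt0P[y yp gy] : 0 < lehmer g p by lia.
  by have := minP k0 kM y yp; lia.
Qed.

(** The only new pair is [r] and [p.-1], and [p.-1] had no earlier edge. If [k = 0] the centre is
    chosen to be [r]; otherwise [r = R] because both are the minimum of the prefix. *)
Lemma star_inv_two p k a R h : star_inv p k a R h -> lehmer g p = 2 -> a = 1 -> k < m ->
  exists R', star_inv p.+1 k.+1 2 R' (fun i => if i < k then h i else p.-1).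
Proof.
move=> inv c a1 klm; have hlt i := star_inv_lt inv (i := i).
move: inv => [km last av mono root edge edges minP].
have p2 : 1 < p by have := lehmer_le g p; lia.
have c1 : lehmer g p.-1 = 1 by rewrite last //; lia.
have [r [rq below rmin]] := below_two c c1.
have rR : 0 < k -> r = R.
  move=> k0; apply/eqP; rewrite -[_ == _]negbK; apply/negP => rR.
  have Rp : R < p by have := root 0 k0; have := hlt 0 k0; lia.
  have := minP k0 klm r; have := rmin R; lia.
have belowr x : x < p -> g x < g p -> x = r \/ x = p.-1.
  by move=> xp; rewrite below // => /orP[]/eqP->; [left|right].
exists r; set h' := fun i => _.
have hE i : i < k -> h' i = h i by rewrite /h' => ->.
have hk : h' k = p.-1 by rewrite /h' ltnn.
have comS u v : u < v -> v != p.-1 -> common_above p.+1 u v = common_above p u v.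
  move=> uv vq; rewrite common_aboveS; case: and4P => [[up vp gu gv]|]; last by lia.
  by have [] := belowr v vp gv; have [] := belowr u up gu; lia.
have comq u : u < p.-1 -> common_above p.+1 u p.-1 = (u == r).
  move=> uq; rewrite common_aboveS.
  have -> : common_above p u p.-1 = 0.
    by apply/eqP; rewrite -leqn0 leqNgt; apply/negP => /common_above_gt0P[x []]; lia.
  by rewrite !below ?eqxx ?orbT; lia.
split=> //.
- move=> x y w xy yw wp gx gy; case: (eqVneq w p) => [e|ne]; last by apply: (av x y w); lia.
  subst w; have ey : y = p.-1.
    by have [] := belowr y yw gy; have [] := belowr x (ltn_trans xy yw) gx; lia.
  have ex : x = r by have [] := belowr x (ltn_trans xy yw) gx; lia.
  by rewrite ex ey; apply: rmin; lia.
- move=> i j ij; rewrite ltnS leq_eqVlt => /orP[/eqP ejk|jk].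
    by rewrite ejk hk hE; [apply: hlt|]; lia.
  by rewrite !hE ?mono //; lia.
- move=> i; rewrite ltnS leq_eqVlt => /orP[/eqP->|ik]; first by rewrite hk.
  by rewrite hE // rR ?root //; lia.
- move=> i; rewrite ltnS leq_eqVlt => /orP[/eqP->|ik]; first by rewrite hk comq ?eqxx.
  have k0 : 0 < k by lia.
  by rewrite hE // rR // comS ?edge ?root //; have := hlt i ik; lia.
- move=> u v uv cc; case: (eqVneq v p.-1) => [e|ne].
    by subst v; move: cc; rewrite comq // lt0b => /eqP ->; split=> //; exists k; rewrite ?hk.
  move: cc; rewrite comS // => /(edges u v uv)[-> [i ik ->]].
  by split; [rewrite rR //; lia | exists i; [lia | rewrite hE]].
- move=> _ _ x; rewrite ltnS leq_eqVlt => /orP[/eqP->|xp].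
    by apply/ltnW; rewrite below ?eqxx //; lia.
  by case: (eqVneq x r) => [->|xr] //; apply/ltnW/rmin.
Qed.

Lemma run_star_inv p k a : rstate g (sstep m) p = Some (k, a) ->
  exists R h, star_inv p k a R h.
Proof.
elim: p k a => [|p IH] k a; first by move=> [<- <-]; exists 0, id; exact: star_inv0.
rewrite rstateS; case: (rstate _ _ p) IH => [[k' a'] /(_ _ _ erefl)[R [h inv]]|//] /=.
case: (eqVneq (lehmer g p) 0) => [c0|c0].
  case: ifP => // kk [<- <-]; exists R, h; rewrite -[X in star_inv _ _ X]c0.
  by apply: star_inv_small inv _ _; rewrite ?c0 ?kk.
case: (eqVneq (lehmer g p) 1) => [c1 [<- <-]|c1].
  by exists R, h; rewrite -[X in star_inv _ _ X]c1; apply: star_inv_small inv _ _; rewrite c1.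
case: ifP => // /andP[/andP[/eqP c2 /eqP a1] klm] [<- <-].
by have [R' inv'] := star_inv_two inv c2 a1 klm; exists R'; eexists; exact: inv'.
Qed.

(** * Completeness for stars: every rejected letter contradicts the shape of the graph *)

Section Complete.
Variable n : nat.
Hypotheses (m_gt0 : 0 < m) (comp : component n m.+1 (common_above n))
  (av : forall x y w, x < y -> y < w -> w < n -> g x < g w -> g y < g w -> g x < g y).

Let in_star p k a R h u v : star_inv p k a R h -> u != v ->
  0 < common_above p u v -> u \in R :: mkseq h k.
Proof.
move=> inv; rewrite inE neq_ltn => /orP[uv|vu].
  by case/(si_edges inv uv) => -> _; rewrite eqxx.
rewrite common_aboveC => /(si_edges inv vu)[_ [i ik ->]].
by apply/orP; right; apply/mapP; exists i; rewrite ?mem_iota.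
Qed.

Lemma run_star_complete p : p <= n -> rstate g (sstep m) p.
Proof.
elim: p => // p IH pn.
case E : (rstate g (sstep m) p) (IH (ltnW pn)) => [[k a]|] // _.
have [R [h inv]] := run_star_inv E.
have hlt i := star_inv_lt inv (i := i).
have [km last _ mono root edge edges minP] := inv.
rewrite rstateS E /=; case: (eqVneq (lehmer g p) 0) => [c0|c0].
  case: ifP => // /negbT; rewrite negb_or => /andP[k0 kM]; exfalso.
  (* An arc across the new minimum [p] would form 213 with it, so no edge crosses [p] and the star
     keeps only [k < m] leaves. *)
  have k0' : 0 < k by lia.
  have /eqP/lehmer0P np := c0.
  have sep u x : u < p -> p <= x -> x < n -> g u < g x -> False.
    move=> up px xn gu; case: (eqVneq x p) => [e|ne]; first by subst x; have := np u; lia.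
    have px' : p < x by lia.
    have gpu := np u up; have := av up px' xn gu; lia.
  have cut u v : u < p -> p <= v -> v < n -> common_above n u v = 0.
    move=> up pv vn; apply/eqP; rewrite -leqn0 leqNgt; apply/negP.
    by case/common_above_gt0P => x [xn ux vx gu _]; apply: (sep u x); lia.
  have Rh := root 0 k0'; have hp : h 0 < p by have := hlt 0 k0'; lia.
  have e0 : 0 < common_above n R (h 0).
    by apply: leq_trans (common_above_leq _ _ (ltnW pn)); rewrite edge.
  have inp u v := comp_cut comp cut Rh hp (ltn_trans hp pn) e0 (u := u) (v := v).
  suff : m.+1 <= size (R :: mkseq h k) by rewrite /= size_mkseq; lia.
  apply: (comp_lower comp) => u v un vn uv cc.
  apply: (in_star inv uv); have up := inp u v un vn uv cc.
  move: cc => /common_above_gt0P[x [xn ux vx gu gv]]; apply/common_above_gt0P.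
  exists x; split=> //; rewrite ltnNge; apply/negP => px.
  exact: sep up px xn gu.
case: (eqVneq (lehmer g p) 1) => [//|c1].
have p0 : 0 < p by have := lehmer_le g p; lia.
have up : p.-1 < p by lia.
have e1 := last p0.
have uniq_below : uniq [seq x <- iota 0 p | g x < g p] by rewrite filter_uniq ?iota_uniq.
have mem_below x : x \in [seq x <- iota 0 p | g x < g p] -> x < p /\ g x < g p.
  by rewrite mem_filter mem_iota => /andP[-> /andP[_ ->]].
have cE : lehmer g p = size [seq x <- iota 0 p | g x < g p] by rewrite size_filter.
have ex2 : exists x y, [/\ x < y, y < p, g x < g p & g y < g p].
  case F : [seq x <- iota 0 p | g x < g p] cE uniq_below mem_below => [|x [|y l]] /=; try lia.
  move=> _; rewrite inE negb_or => /andP[/andP[xy _] _] mb.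
  have [xp gx] := mb x (mem_head _ _).
  have [yp gy] : y < p /\ g y < g p by apply: mb; rewrite !inE eqxx orbT.
  move: xy; rewrite neq_ltn => /orP[xy|yx]; first by exists x, y.
  by exists y, x.
case: (ltnP 2 (lehmer g p)) => [c3|c2].
  exfalso.
  (* Three smaller predecessors share the out-neighbour [p] and form a triangle. *)
  have srt : sorted ltn [seq x <- iota 0 p | g x < g p].
    by apply: sorted_filter (iota_ltn_sorted 0 p); exact: ltn_trans.
  case F : [seq x <- iota 0 p | g x < g p] cE srt mem_below => [|x [|y [|w l]]] /=; try lia.
  move=> _ /and3P[xy yw _] mb.
  have [xp gx] := mb x (mem_head _ _).
  have [yp gy] : y < p /\ g y < g p by apply: mb; rewrite !inE eqxx orbT.
  have [wp gw] : w < p /\ g w < g p by apply: mb; rewrite !inE eqxx !orbT.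
  by apply: (comp_triangle comp xy yw (ltn_trans wp pn));
    apply/common_above_gt0P; exists p.
have c : lehmer g p = 2 by lia.
have qp : p.-1 != p by lia.
case: (eqVneq a 1) => [a1|a1]; last first.
  (* A 2 not preceded by 1. If [g p.-1 < g p], avoidance of 213 makes the previous letter positive,
     hence at least 2, and [p] has three smaller predecessors. Otherwise [x] and [y] share both
     [p.-1] and [p]. *)
  exfalso; have [x [y [xy yp gx gy]]] := ex2.
  case: (ltnP (g p.-1) (g p)) => gq.
    have xq : x < p.-1 by lia.
    have gxq : g x < g p.-1 by apply: (av xq up pn).
    have a2 : 1 < lehmer g p.-1.
      have : 0 < lehmer g p.-1 by apply/lehmer_gt0P; exists x.
      by lia.
    have [|x1 [y1 []]] := count_gt1P _ a2; first exact: iota_uniq.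
    rewrite !mem_iota => x1q y1q gx1 gy1 xy1.
    suff : size [:: x1; y1; p.-1] <= lehmer g p by rewrite c.
    apply: uniq_count_le => /=; first by rewrite !inE; lia.
      by move=> i; rewrite !inE mem_iota; lia.
    by lia.
  have gpq : g p < g p.-1 by have := gneq qp; lia.
  have yq : y != p.-1 by apply: contraTneq gy => ->; lia.
  have := comp_le1 comp (ltn_trans xy (ltn_trans yp pn)) (ltn_trans yp pn).
  rewrite neq_ltn xy => /(_ isT).
  suff : size [:: p.-1; p] <= common_above n x y by rewrite /=; lia.
  apply: uniq_count_le => /=; first by rewrite !inE; lia.
    by move=> i; rewrite !inE mem_iota; lia.
  by lia.
case: (ltnP k m) => klm; first by rewrite c.
exfalso; have ekm : k = m by lia.
have k0 : 0 < k by lia.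
have [r [rq below rmin]] := below_two c (etrans e1 a1).
(* All leaves lie before [p.-1], so its edge to [r] adds a vertex to the [m + 1] already
   non-isolated. *)
suff : size (rcons (R :: mkseq h k) p.-1) <= m.+1.
  by rewrite size_rcons /= size_mkseq; lia.
have hn i : i < k -> h i < n by move=> ik; have := hlt i ik; lia.
have en i : i < k -> 0 < common_above n R (h i).
  by move=> ik; apply: leq_trans (common_above_leq _ _ (ltnW pn)); rewrite edge.
have Rn : R < n by have := root 0 k0; have := hn 0 k0; lia.
apply: (comp_upper comp).
  rewrite rcons_uniq /= inE negb_or map_inj_in_uniq ?iota_uniq ?andbT.
    rewrite -andbA; apply/and3P; split.
    - by have := root 0 k0; have := hlt 0 k0; lia.
    - by apply/mapP => -[i]; rewrite mem_iota => ik e; have := hlt i; lia.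
    - by apply/mapP => -[i]; rewrite mem_iota => ik e; have := root i; lia.
  move=> i j; rewrite !mem_iota => ik jk e.
  by case: (ltngtP i j) => // ij; have := mono _ _ ij; rewrite e; lia.
move=> u; rewrite mem_rcons !inE => /or3P[/eqP->|/eqP->|/mapP[i]].
- split; first by lia.
  exists r; first by lia.
  apply/andP; split; first by lia.
  have rp : r < p by lia.
  by apply/common_above_gt0P; exists p; rewrite !below ?eqxx ?orbT //; split.
- split=> //; exists (h 0); first exact: hn.
  by rewrite en // neq_ltn root.
- rewrite mem_iota => ik ->; split; first by apply: hn; lia.
  exists R => //; rewrite common_aboveC en; last by lia.
  by rewrite eq_sym neq_ltn root //; lia.
Qed.

Lemma star_accepts : accepts m (rstate g (sstep m) n).
Proof.
case E : (rstate _ (sstep m) n) (run_star_complete (leqnn n)) => [[k a]|] // _ /=.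
have [R [h inv]] := run_star_inv E.
have : m.+1 <= size (R :: mkseq h k).
  by apply: (comp_lower comp) => u v un vn uv cc; exact: in_star inv uv cc.
by rewrite /= size_mkseq; have := si_le inv; lia.
Qed.

End Complete.

End Star.

(** * Competition graphs *)

(** The isolated vertices are those outside the image of [e], which determines [r]. *)
Lemma iso_add_isolatedP (G H : wgraph) :
  (exists r, wg_iso H (add_isolated G r)) <->
  exists e : vert G -> vert H,
    [/\ injective e, forall x y, adj (e x) (e y) = adj x y,
        forall x y, adj x y -> wt (e x) (e y) = wt x y
      & forall u v, adj u v -> exists x, u = e x].
Proof.
split=> [[r [f [[f' fK f'K] fadj fwt]]]|[e [eI eadj ewt eall]]].
  exists (fun x => f' (inl x)); split.
  - by move=> x y /(can_inj f'K)[].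
  - by move=> x y; rewrite -fadj !f'K.
  - by move=> x y xy; rewrite -fwt ?f'K // -fadj !f'K.
  - move=> u v; rewrite -fadj /=; case E : (f u) => [x|i] //= _.
    by exists x; rewrite -E fK.
pose A := ~: [set e x | x in vert G].
pose f' (x : vert G + 'I_#|A|) := match x with inl y => e y | inr i => enum_val i end.
have eA x (i : 'I_#|A|) : e x <> enum_val i.
  move=> ex; have := enum_valP i; rewrite -ex inE; case/negP.
  exact: imset_f.
have f'I : injective f'.
  move=> [x|i] [y|j] //=.
  - by move/eI->.
  - by move/eA.
  - by move/esym/eA.
  - by move/enum_val_inj->.
have f'S u : exists x, f' x = u.
  case: (boolP (u \in A)) => [uA|].
    by exists (inr (enum_rank_in uA u)); rewrite /= enum_rankK_in.
  by rewrite inE negbK => /imsetP[x _ ->]; exists (inl x).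
have [f f'K] := choice f'S.
have fK x : f (f' x) = x by apply: f'I; rewrite f'K.
have adjE x y : isol_adj x y = adj (f' x) (f' y).
  have nA (i : 'I_#|A|) v : adj (enum_val i) v = false.
    by apply/negP => /eall[z] /esym /eA.
  by case: x y => [x|i] [y|j] //=; rewrite ?eadj ?nA // adj_sym nA.
exists #|A|, f; split; first by exists f'.
  by move=> u v; rewrite /= adjE !f'K.
move=> u v uv; rewrite -[u in RHS]f'K -[v in RHS]f'K /=.
have : isol_adj (f u) (f v) by rewrite adjE !f'K.
by case: (f u) (f v) => [x|i] [y|j] //= /ewt ->.
Qed.

Record embedding n (com : nat -> nat -> nat) (V : finType) (a : rel V) (e : V -> nat) : Prop :=
  Embedding {
    emb_inj : injective e;
    emb_lt : forall x, e x < n;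
    emb_adj : forall x y, x != y -> (0 < com (e x) (e y)) = a x y;
    emb_wt : forall x y, a x y -> com (e x) (e y) = 1;
    emb_all : forall u v, u < n -> v < n -> u != v -> 0 < com u v -> exists x, u = e x
  }.

(** The involution [phi] renames the vertices: the identity for paths, the reversal of positions for
    stars. *)
Lemma competition_embeddingP n (s : 'S_n) (com : nat -> nat -> nat) (phi : 'I_n -> 'I_n)
    (V : finType) (a : rel V) (aS : symmetric a) (aI : irreflexive a) :
  involutive phi -> (forall u v, #|common_out s u v| = com (phi u) (phi v)) ->
  (exists r, wg_iso (competition_graph s) (add_isolated (unit_wgraph aS aI) r)) <->
  exists e, embedding n com a e.
Proof.
move=> phiK comE; rewrite iso_add_isolatedP /=.
have adjE u v : comp_adj s u v = (u != v) && (0 < com (phi u) (phi v)).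
  by rewrite /comp_adj -card_gt0 comE.
split=> [[e [eI eadj ewt eall]]|[e [eI elt eadj ewt eall]]].
  exists (fun x => val (phi (e x))); split.
  - by move=> x y /val_inj/(can_inj phiK)/eI.
  - by move=> x; exact: ltn_ord.
  - move=> x y xy; rewrite -eadj adjE -[LHS]andTb; congr (_ && _).
    by rewrite (inj_eq eI) xy.
  - by move=> x y /ewt; rewrite /comp_wt comE.
  - move=> u v un vn uv cc.
    have : comp_adj s (phi (Ordinal un)) (phi (Ordinal vn)).
      by rewrite adjE !phiK /= cc (inj_eq (can_inj phiK)) andbT.
    by case/eall => x ex; exists x; rewrite -ex phiK.
exists (fun x => phi (Ordinal (elt x))); split.
- by move=> x y /(can_inj phiK)[]/eI.
- move=> x y; rewrite adjE !phiK (inj_eq (can_inj phiK)) -val_eqE /= (inj_eq eI).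
  by case: eqVneq => [->|/eadj] //=; rewrite aI.
- by move=> x y /ewt; rewrite /comp_wt comE !phiK.
- move=> u v; rewrite adjE => /andP[uv cc].
  have [|x ex] := eall (phi u) (phi v) (ltn_ord _) (ltn_ord _) _ cc.
    by rewrite (inj_eq val_inj) (inj_eq (can_inj phiK)).
  by exists x; apply: (can_inj phiK); rewrite phiK; exact: val_inj.
Qed.

(** Connectedness of [a] is expressed by saying that a predicate constant along edges is constant;
    it is applied to the side of a cut on which [e x] lies. *)
Lemma embedding_component n com (V : finType) (a : rel V) (e : V -> nat) :
    (forall u v, com u v = com v u) -> irreflexive a -> (forall x, exists y, a x y) ->
    (forall x y z, a x y -> a y z -> a x z -> False) ->
    (forall X : pred V, (forall x y, a x y -> X x = X y) -> forall x y, X x = X y) ->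
  embedding n com a e -> component n #|V| com.
Proof.
move=> comC aI anb atri acon [eI elt eadj ewt eall].
have edge u v : u < n -> v < n -> u != v -> 0 < com u v ->
    exists x y, [/\ u = e x, v = e y, x != y & a x y].
  move=> un vn uv cc; have [x ex] := eall u v un vn uv cc.
  have [||y ey] := eall v u vn un; first by rewrite eq_sym.
    by rewrite comC.
  exists x, y; have xy : x != y by rewrite -(inj_eq eI) -ex -ey.
  by split=> //; rewrite -eadj // -ex -ey.
split=> //.
- move=> u v un vn uv; case: (posnP (com u v)) => [->//|].
  by case/(edge u v un vn uv) => x [y [-> -> _ /ewt ->]].
- move=> u v w uv vw wn c1 c2 c3.
  have vn := ltn_trans vw wn; have un := ltn_trans uv vn.
  have [|x [y [ex ey _ axy]]] := edge u v un vn _ c1; first by lia.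
  have [|y' [z [ey' ez _ ayz]]] := edge v w vn wn _ c2; first by lia.
  have [|x' [z' [ex' ez' _ axz]]] := edge u w un wn _ c3; first by lia.
  apply: (atri x y z) => //; first by rewrite (eI y y') // -ey.
  by rewrite (eI x x') -?ex // (eI z z') // -ez.
- move=> p cut u0 v0 uv0 vp0 vn0 c0 u v un vn uv cc.
  have [|x0 [_ [ex0 _ _ _]]] := edge u0 v0 (ltn_trans uv0 vn0) vn0 _ c0; first by lia.
  have [x [_ [ex _ _ _]]] := edge u v un vn uv cc.
  have : (e x < p) = (e x0 < p).
    apply: (acon (fun x => e x < p)) => y z ayz.
    have c1 := ewt _ _ ayz; have c2 : com (e z) (e y) = 1 by rewrite comC.
    case: (ltnP (e y) p) => yp; case: (ltnP (e z) p) => zp //.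
      by have := cut (e y) (e z) yp zp (elt z); rewrite c1.
    by have := cut (e z) (e y) zp yp (elt y); rewrite c2.
  by rewrite -ex -ex0; lia.
- move=> L uL HL; rewrite cardE -(size_map e); apply: uniq_leq_size => // u /HL[un [v vn /andP[uv cc]]].
  have [x ex] := eall u v un vn uv cc.
  by rewrite ex map_f // mem_enum.
- move=> L HL; rewrite cardE -(size_map e); apply: uniq_leq_size.
    by rewrite map_inj_uniq ?enum_uniq.
  move=> _ /mapP[x _ ->]; have [y axy] := anb x.
  apply: (HL _ (e y)) => //; last by rewrite ewt.
  by rewrite (inj_eq eI); apply: contraTneq axy => ->; rewrite aI.
Qed.

Lemma path_component n com m e : 0 < m -> (forall u v, com u v = com v u) ->
  embedding n com (@path_adj m) e -> component n m.+1 com.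
Proof.
move=> m0 comC /(embedding_component comC); rewrite card_ord; apply.
- exact: path_adj_irr.
- move=> x; case: (ltnP x m) => xm.
    have xm1 : x.+1 < m.+1 by [].
    by exists (Ordinal xm1); rewrite /path_adj /= eqxx.
  have xm1 : x.-1 < m.+1 by have := ltn_ord x; lia.
  by exists (Ordinal xm1); rewrite /path_adj /=; lia.
- by move=> x y z; rewrite /path_adj; lia.
- move=> X HX; suff H (x : 'I_m.+1) : X x = X ord0 by move=> x y; rewrite !H.
  case: x => x; elim: x => [|x IH] xm; first by congr X; exact: val_inj.
  rewrite -(IH (ltnW xm)); apply: HX; rewrite /path_adj /= eqxx orbT //.
Qed.

Lemma star_component n com m e : 0 < m -> (forall u v, com u v = com v u) ->
  embedding n com (@star_adj m) e -> component n m.+1 com.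
Proof.
move=> m0 comC /(embedding_component comC); rewrite card_ord; apply.
- exact: star_adj_irr.
- move=> x; case: (eqVneq x ord0) => [->|x0]; last by exists ord0; rewrite /star_adj x0 eqxx orbT.
  have m1 : 1 < m.+1 by [].
  by exists (Ordinal m1); rewrite /star_adj.
- by move=> x y z; rewrite /star_adj -!val_eqE /=; lia.
- move=> X HX; suff H (x : 'I_m.+1) : X x = X ord0 by move=> x y; rewrite !H.
  by case: (eqVneq x ord0) => [-> //|x0]; apply: HX; rewrite /star_adj x0 eqxx orbT.
Qed.

Lemma path_embedding m g n k z h : 0 < m -> path_inv m g n k z h -> k = m ->
  embedding n (common_below g) (@path_adj m) (fun i => h i).
Proof.
move=> m0 inv km.
have mh i j : i < j -> j <= m -> h i < h j.
  elim: j => // j IHj; rewrite ltnS leq_eqVlt => /orP[/eqP ->|ij] jk.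
    by apply: (pi_mono inv); rewrite km.
  apply: ltn_trans (_ : h j < _); first by apply: IHj => //; lia.
  by apply: (pi_mono inv); rewrite km.
have hI i j : i <= m -> j <= m -> h i = h j -> i = j.
  by move=> im jm e; case: (ltngtP i j) => // ij; have := mh _ _ ij; rewrite e; lia.
have hlt i : i <= m -> h i < n by move=> im; apply: (pi_lt inv); lia.
have edges i j : i < j -> j <= m -> (0 < common_below g (h i) (h j)) = (i.+1 == j).
  move=> ij jm; apply/idP/eqP => [|<-]; last by rewrite (pi_edge inv) //; lia.
  case/(pi_edges inv (mh _ _ ij jm) (hlt _ jm)) => l [lk e1 e2].
  have -> : i = l by apply: hI e1; lia.
  by apply: hI => //; lia.
split.
- by move=> i j /hI e; apply: val_inj; apply: e; rewrite -ltnS.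
- by move=> i; apply: hlt; rewrite -ltnS.
- move=> i j; rewrite -val_eqE /= neq_ltn /path_adj => /orP[ij|ji].
    by rewrite edges; have := ltn_ord j; lia.
  by rewrite common_belowC edges; have := ltn_ord i; lia.
- move=> i j; rewrite /path_adj => /orP[/eqP ij|/eqP ji].
    by rewrite -ij; apply: (pi_edge inv); have := ltn_ord j; lia.
  by rewrite common_belowC -ji; apply: (pi_edge inv); have := ltn_ord i; lia.
- have ord i : i <= m -> exists x : 'I_m.+1, h i = h x.
    by move=> im; have im' : i < m.+1 by []; exists (Ordinal im').
  move=> u v un vn; rewrite neq_ltn => /orP[uv|vu].
    by case/(pi_edges inv uv vn) => i [ik -> _]; apply: ord; lia.
  rewrite common_belowC; case/(pi_edges inv vu un) => i [ik _ ->]; apply: ord; lia.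
Qed.

(** Vertex 0 is the centre, so leaf [i] of the star graph corresponds to [h i.-1]. *)
Lemma star_embedding m g n k a R h : 0 < m -> star_inv m g n k a R h -> k = m ->
  embedding n (common_above g n) (@star_adj m) (fun i => if i == 0 :> nat then R else h i.-1).
Proof.
move=> m0 inv km.
have hI i j : i < m -> j < m -> h i = h j -> i = j.
  by move=> im jm e; case: (ltngtP i j) => // ij; have := si_mono inv ij; rewrite e; lia.
have hlt i : i < m -> h i < n by move=> im; have := star_inv_lt inv (i := i); lia.
have root i : i < m -> R < h i by move=> im; apply: (si_root inv); lia.
have edge i : i < m -> common_above g n R (h i) = 1 by move=> im; apply: (si_edge inv); lia.
have Rn : R < n by have := root 0 m0; have := hlt 0 m0; lia.
have nohh i j : i < m -> j < m -> i < j -> common_above g n (h i) (h j) = 0.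
  move=> im jm ij; apply/eqP; rewrite -leqn0 leqNgt; apply/negP => cc.
  have hij : h i < h j by apply: (si_mono inv); lia.
  by have [e _] := si_edges inv hij cc; have := root i im; lia.
have pm (i : 'I_m.+1) : (i == 0 :> nat) = false -> i.-1 < m by have := ltn_ord i; lia.
split.
- move=> i j; case E1 : (i == 0 :> nat); case E2 : (j == 0 :> nat) => e; apply: val_inj => /=.
  + by lia.
  + by have := root _ (pm j E2); lia.
  + by have := root _ (pm i E1); lia.
  + by have := hI _ _ (pm i E1) (pm j E2) e; lia.
- by move=> i; case E1 : (i == 0 :> nat) => //; apply: hlt; exact: pm.
- move=> i j ij; rewrite /star_adj ij -!val_eqE /=; move: ij; rewrite -val_eqE /=.
  case E1 : (i == 0 :> nat); case E2 : (j == 0 :> nat) => ij //=.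
  + by lia.
  + by rewrite edge //; exact: pm.
  + by rewrite common_aboveC edge //; exact: pm.
  + case: (ltngtP i j) ij => // ij _.
      by rewrite nohh ?pm //; lia.
    by rewrite common_aboveC nohh ?pm //; lia.
- move=> i j; rewrite /star_adj -!val_eqE /=.
  case E1 : (i == 0 :> nat); case E2 : (j == 0 :> nat) => //=; rewrite ?andbF //.
  + by lia.
  + by rewrite edge //; exact: pm.
  + by rewrite common_aboveC edge //; exact: pm.
- have ord i : i < m -> exists x : 'I_m.+1, h i = (if x == 0 :> nat then R else h x.-1).
    by move=> im; have im' : i.+1 < m.+1 by []; exists (Ordinal im').
  move=> u v un vn; rewrite neq_ltn => /orP[uv|vu].
    by case/(si_edges inv uv) => -> _; exists ord0.
  by rewrite common_aboveC; case/(si_edges inv vu) => _ [i ik ->]; apply: ord; lia.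
Qed.

(** * Patterns of length 3, weights of pairs and the reverse-complement *)

Lemma contains3P n (s : 'S_n) (t : 'S_3) :
  contains s t <-> exists x y w : 'I_n, [/\ x < y, y < w,
    (s x < s y) = (t (@Ordinal 3 0 isT) < t (@Ordinal 3 1 isT)),
    (s x < s w) = (t (@Ordinal 3 0 isT) < t (@Ordinal 3 2 isT))
  & (s y < s w) = (t (@Ordinal 3 1 isT) < t (@Ordinal 3 2 isT))].
Proof.
split=> [[f [fm fs]]|[x [y [w [xy yw e1 e2 e3]]]]].
  by exists (f (@Ordinal 3 0 isT)), (f (@Ordinal 3 1 isT)), (f (@Ordinal 3 2 isT)); split;
    rewrite ?fs ?fm.
exists (fun i : 'I_3 => nth x [:: x; y; w] i); split.
  by case=> [[|[|[|//]]] ?] [[|[|[|//]]] ?] //= _; lia.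
(* Comparisons in the opposite order follow from the three given ones by injectivity. *)
have anti k (u : 'S_k) (i j : 'I_k) : i != j -> (u i < u j) = ~~ (u j < u i).
  move=> ij; have : u i != u j by rewrite (inj_eq perm_inj).
  by rewrite -val_eqE /=; lia.
have ne3 (a b : 'I_3) : val a != val b -> a != b by [].
have ne (a b : 'I_n) : a < b -> b != a by move=> ab; rewrite -val_eqE /=; lia.
have [[nyx nwy] nwx] := (ne _ _ xy, ne _ _ yw, ne _ _ (ltn_trans xy yw)).
case=> [[|[|[|//]]] i] [[|[|[|//]]] j] /=;
  rewrite (bool_irrelevance i isT) (bool_irrelevance j isT) ?ltnn //.
- by rewrite anti // [RHS]anti ?ne3 // e1.
- by rewrite anti // [RHS]anti ?ne3 // e2.
- by rewrite anti // [RHS]anti ?ne3 // e3.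
Qed.

Lemma card_ord_count n (a : pred nat) : #|[set x : 'I_n | a x]| = count a (iota 0 n).
Proof.
rewrite cardsE cardE -val_enum_ord count_map -size_filter /enum_mem -filter_predI.
by congr size; apply: eq_filter => x; rewrite /= andbT.
Qed.

Lemma count_iota_lt n k (a : pred nat) : k <= n ->
  count (fun x => (x < k) && a x) (iota 0 n) = count a (iota 0 k).
Proof.
move=> kn; rewrite -(subnKC kn) iotaD count_cat -[RHS]addn0; congr (_ + _).
  by apply: eq_in_count => x; rewrite mem_iota => /andP[_ ->].
by apply/eqP; rewrite -leqn0 leqNgt -has_count; apply/hasPn => x; rewrite mem_iota; lia.
Qed.

Lemma card_common_out n (s : 'S_n) (u v : 'I_n) :
  #|common_out s u v| = common_below (perm_fun s) u v.
Proof.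
pose a x := (x < minn u v) &&
  ((perm_fun s x < perm_fun s u) && (perm_fun s x < perm_fun s v)).
rewrite /common_below -(count_iota_lt (n := n)); last by have := ltn_ord u; lia.
rewrite -(card_ord_count n a); congr #|pred_of_set _|; apply/setP => x.
by rewrite !inE /darc /a !perm_funE; lia.
Qed.

(** Reversing positions and values turns the code into a list of in-degrees: a letter [c] counts the
    vertices having that position as an out-neighbour, and these form a clique. *)
Definition revcomp n (s : 'S_n) : 'S_n :=
  (perm (@rev_ord_inj n) * s * perm (@rev_ord_inj n))%g.

Lemma revcompE n (s : 'S_n) i : revcomp s (rev_ord i) = rev_ord (s i).
Proof. by rewrite !permM !permE rev_ordK. Qed.

Lemma revcomp_inj n : injective (@revcomp n).
Proof. by move=> s t /mulIg/mulgI. Qed.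

Lemma revcomp_ltn n (s : 'S_n) (i j : 'I_n) :
  (perm_fun (revcomp s) (rev_ord i) < perm_fun (revcomp s) (rev_ord j)) = (s j < s i).
Proof.
rewrite !perm_funE !revcompE /=; have := ltn_ord (s i); have := ltn_ord (s j); lia.
Qed.

Lemma card_common_out_revcomp n (s : 'S_n) (u v : 'I_n) :
  #|common_out s u v| = common_above (perm_fun (revcomp s)) n (rev_ord u) (rev_ord v).
Proof.
rewrite /common_above -card_ord_count -(card_imset _ rev_ord_inj).
congr #|pred_of_set _|; apply/setP => x.
rewrite -[x]rev_ordK (mem_imset _ _ rev_ord_inj) !inE !revcomp_ltn /darc.
have rl (i j : 'I_n) : (rev_ord i < rev_ord j) = (j < i).
  by rewrite /=; have := ltn_ord i; have := ltn_ord j; lia.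
by rewrite !rl !rev_ordK; lia.
Qed.

Lemma avoids123P n (s : 'S_n) : avoids s pat123 <->
  forall x y w, x < y -> y < w -> w < n ->
    perm_fun s x < perm_fun s y -> perm_fun s y < perm_fun s w -> False.
Proof.
rewrite /avoids contains3P !perm1 /=; split=> [nc x y w xy yw wn|H [x [y [w [xy yw]]]]].
  have yn := ltn_trans yw wn; have xn := ltn_trans xy yn.
  rewrite (perm_funE s (Ordinal xn)) (perm_funE s (Ordinal yn)) (perm_funE s (Ordinal wn)).
  move=> gxy gyw; apply: nc; exists (Ordinal xn), (Ordinal yn), (Ordinal wn).
  by split=> //; lia.
move=> e1 _ e3; apply: (H x y w) => //; rewrite !perm_funE; [exact: e1|exact: e3].
Qed.

Lemma pat132E (a : 'I_3) : pat132 a = nth 0 [:: 0; 2; 1] a :> nat.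
Proof.
rewrite permE /= -!val_eqE /= !inordK //.
by case: a => [[|[|[|//]]] ?] /=; rewrite ?inordK.
Qed.

Lemma avoids132P n (s : 'S_n) : let g := perm_fun (revcomp s) in
  avoids s pat132 <->
  forall x y w, x < y -> y < w -> w < n -> g x < g w -> g y < g w -> g x < g y.
Proof.
move=> g; rewrite /avoids contains3P !pat132E /=.
split=> [nc x y w xy yw wn|H [x [y [w [xy yw]]]]].
  have yn := ltn_trans yw wn; have xn := ltn_trans xy yn.
  pose X := rev_ord (Ordinal xn); pose Y := rev_ord (Ordinal yn).
  pose W := rev_ord (Ordinal wn).
  have -> : x = rev_ord X by rewrite rev_ordK.
  have -> : y = rev_ord Y by rewrite rev_ordK.
  have -> : w = rev_ord W by rewrite rev_ordK.
  rewrite !revcomp_ltn => sxw syw; rewrite ltnNge; apply/negP => sxy; apply: nc.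
  exists W, Y, X.
  have : s X != s Y by rewrite (inj_eq perm_inj) -val_eqE /=; lia.
  rewrite -val_eqE /= => nxy.
  by split=> //=; lia.
move=> e1 e2 e3.
have := H (rev_ord w) (rev_ord y) (rev_ord x).
rewrite !revcomp_ltn e1 e2 /=.
have := ltn_ord x; have := ltn_ord y; have := ltn_ord w => wn yn xn.
have a1 : n - w.+1 < n - y.+1 by lia.
have a2 : n - y.+1 < n - x.+1 by lia.
have a3 : n - x.+1 < n by lia.
by move/(_ a1 a2 a3 isT isT); lia.
Qed.

Lemma rstate_code n (s : 'S_n) step : rstate (perm_fun s) step n = run step (code s).
Proof. by []. Qed.

(** * Acceptance by the automata characterises both families *)

Lemma Winv_path m n (s : 'S_n) : 0 < m ->
  (s \in Winv n (path_graph m) pat123) = accepts m (run (pstep m) (code s)).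
Proof.
move=> m0; rewrite inE -rstate_code; have gI := @perm_fun_inj n s.
have embP := competition_embeddingP (path_adj_sym (m := m)) (path_adj_irr (m := m))
  (phi := id) (fun _ => erefl) (card_common_out s).
apply/asboolP/idP => [[/avoids123P av /embP[e emb]]|].
  apply: path_accepts => //; apply: path_component emb => //; exact: common_belowC.
case E : (rstate _ _ n) => [[k z]|//] /= /eqP km.
have [h inv] := run_path_inv gI E; split.
  apply/avoids123P => x y w xy yw wn gxy gyw.
  have /eqP/lehmer0P/(_ x xy) := pi_avoid inv wn yw gyw; lia.
by apply/embP; eexists; exact: path_embedding inv km.
Qed.

Lemma Winv_star m n (s : 'S_n) : 0 < m ->
  (s \in Winv n (star_graph m) pat132) = accepts m (run (sstep m) (code (revcomp s))).
Proof.
move=> m0; rewrite inE -rstate_code; have gI := @perm_fun_inj n (revcomp s).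
have embP := competition_embeddingP (star_adj_sym (m := m)) (star_adj_irr (m := m))
  (@rev_ordK n) (card_common_out_revcomp s).
apply/asboolP/idP => [[/avoids132P av /embP[e emb]]|].
  apply: star_accepts => //; apply: star_component emb => //; exact: common_aboveC.
case E : (rstate _ _ n) => [[k a]|//] /= /eqP km.
have [R [h inv]] := run_star_inv gI E; split.
  by apply/avoids132P => x y w xy yw wn; exact: (si_avoid inv).
by apply/embP; eexists; exact: star_embedding inv km.
Qed.

Theorem mainTheorem15 (m n : nat) (hm : 1 <= m) (hn : 1 <= n) :
  #|Winv n (path_graph m) pat123| = #|Winv n (star_graph m) pat132|.
Proof.
transitivity #|[set s : 'S_n | accepts m (run (pstep m) (code s))]|.
  by apply: eq_card => s; rewrite Winv_path // inE.
transitivity #|[set s : 'S_n | accepts m (run (sstep m) (code s))]|.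
  by rewrite !(card_code n (fun w => accepts m (run _ w))); exact: count_path_star.
(* The reverse-complement permutes [S_n], so [code s] may be replaced by [code (revcomp s)] in the
   count. *)
rewrite -(card_preimset _ (@revcomp_inj n)).
by apply: eq_card => s; rewrite Winv_star // !inE.
Qed.
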